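(* Let $K\subset\hat{\mathbb{C}}$ be a compactum and $x,y\in K$. Then $(x,y)\in R_K$ if and only if there is an open region $W\subset\hat{\mathbb{C}}$ whose boundary consists of $n\ge2$ pairwise disjoint simple closed curves $\Gamma_1,\ldots,\Gamma_n$ such that $\overline{W}\cap K$ has infinitely many components $P_k$ each intersecting both $\Gamma_1$ and $\Gamma_2$, whose limit $P_\infty=\lim_kP_k$ under the Hausdorff distance satisfies $x\in\Gamma_1\cap P_\infty$ and $y\in\Gamma_2\cap P_\infty$.
   Context: For disjoint simple closed curves $J_1,J_2\subset\hat{\mathbb{C}}$, let $U(J_1,J_2)$ be the component of $\hat{\mathbb{C}}\setminus(J_1\cup J_2)$ whose boundary is $J_1\cup J_2$ (an open annulus). The Schönflies relation $R_K$ on a compactum $K\subset\hat{\mathbb{C}}$: two points $x\ne y$ of $K$ satisfy $(x,y)\in R_K$ if there exist disjoint simple closed curves $J_1\ni x$ and $J_2\ni y$ such that $\overline{U(J_1,J_2)}\cap K$ contains an infinite sequence of distinct components $P_n$, each intersecting both $J_1$ and $J_2$, whose Hausdorff limit $\lim_n P_n$ contains $\{x,y\}$. *)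

(* Defs.v *)
(* The Riemann sphere \hat C is modelled as the unit sphere S2 in R^3
   (stereographic projection is a homeomorphism), with the chordal
   (= Euclidean) metric used for Hausdorff distances. *)
From HB Require Import structures.
From mathcomp Require Import all_boot all_order all_algebra.
From mathcomp Require Import all_classical all_reals all_analysis.
Set Implicit Arguments. Unset Strict Implicit. Unset Printing Implicit Defensive.
Import Order.TTheory GRing.Theory Num.Theory.
Import numFieldNormedType.Exports.
Local Open Scope classical_set_scope.
Local Open Scope ring_scope.

Notation pt R := (R * R * R)%type.

Section Sphere.
Variable R : realType.

Local Notation pt := (R * R * R)%type.

Definition sdist (p q : pt) : R :=
  Num.sqrt ((p.1.1 - q.1.1) ^+ 2 + (p.1.2 - q.1.2) ^+ 2 + (p.2 - q.2) ^+ 2).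

Definition S2 : set pt := [set p | p.1.1 ^+ 2 + p.1.2 ^+ 2 + p.2 ^+ 2 = 1].

Definition sphere_open (W : set pt) : Prop :=
  exists O : set pt, open O /\ W = O `&` S2.

(* boundary of A ⊆ S2 relative to the sphere
   (closures in R^3 of subsets of the closed set S2 stay in S2) *)
Definition sphere_boundary (A : set pt) : set pt :=
  closure A `&` closure (S2 `\` A).

Definition simple_closed_curve (J : set pt) : Prop :=
  J `<=` S2 /\
  exists f : R -> pt,
    {within [set t : R | 0 <= t <= 1], continuous f} /\ f 0 = f 1 /\
    (forall s t : R, 0 <= s < 1 -> 0 <= t < 1 -> f s = f t -> s = t) /\
    J = [set f t | t in [set t : R | 0 <= t <= 1]].

Definition component_of (A C : set pt) : Prop :=
  exists2 p, A p & C = connected_component A p.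

Definition annulus_between (J1 J2 U : set pt) : Prop :=
  component_of (S2 `\` (J1 `|` J2)) U /\ sphere_boundary U = J1 `|` J2.

Definition hausdorff_cvg (P : nat -> set pt) (L : set pt) : Prop :=
  forall e : R, 0 < e -> exists N : nat, forall n : nat, (N <= n)%N ->
    (forall p, P n p -> exists2 q, L q & sdist p q < e) /\
    (forall q, L q -> exists2 p, P n p & sdist p q < e).

Definition schonflies_rel (K : set pt) (x y : pt) : Prop :=
  K x /\ K y /\ x <> y /\
  exists J1 J2 U : set pt,
    [/\ simple_closed_curve J1, simple_closed_curve J2,
        (J1 `&` J2 = set0), J1 x & J2 y] /\ annulus_between J1 J2 U /\
    exists (P : nat -> set pt) (L : set pt),
      injective P /\
      (forall n, [/\ component_of (closure U `&` K) (P n),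
                     (P n `&` J1 !=set0) & (P n `&` J2 !=set0)]) /\
      closed L /\ hausdorff_cvg P L /\ L x /\ L y.

End Sphere.

(* Main.v *)
(** Let [U] be the component of [S2 `\` (G 0 `|` G 1)] that contains [W]. Then [U] agrees with [W]
away from the curves [G i], [2 <= i], so a component of [closure W `&` K] that avoids these curves
is still a component of [closure U `&` K], and the theorem holds with the curves [G 0], [G 1] once
almost all [P k] avoid the others. In fact at most two of the [P k] can meet a given [G i]: three
pairwise disjoint continua in [closure W] meeting [G 0], [G 1] and [G i], together with the three
disjoint sides of these curves opposite to [W], would give a planar drawing of [K_{3,3}].

All the plane topology comes from continuous angles: a nowhere zero continuous map from the plane
to itself has one. This yields Janiszewski's theorem, hence that an arc does not separate the
sphere and that disjoint non-separating discs do not separate it together. A parity count of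
windings shows that [K_{3,3}] is not planar, and from this, following Thomassen, that a simple
closed curve separates the sphere. *)
Require Import Defs.
From HB Require Import structures.
From mathcomp Require Import all_boot all_order all_algebra.
From mathcomp Require Import all_classical all_reals all_analysis.
From mathcomp Require Import ring lra zify.
Import Order.TTheory GRing.Theory Num.Theory.
Import numFieldNormedType.Exports.
Local Open Scope classical_set_scope.
Local Open Scope ring_scope.

Set Implicit Arguments. Unset Strict Implicit. Unset Printing Implicit Defensive.

(** * Connectedness and continuity *)

Section Tools.
Context {T : topologicalType}.

(** Only the converse is hard: the direct implication takes [W = U] and [n = 2]. Passing from [W] to
    [U] enlarges the trace on [K], because [U] also contains what lies beyond the curves [G i],
    [2 <= i]. A component touching such a curve may continue there and merge with others. One that
    avoids them must still be shown not to grow; this comes from a relatively clopen neighbourhood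
    of it that avoids these curves as well. Jordan separation makes the side of each curve opposite
    to [W] nonempty and adherent to the whole curve, so three such sides can serve as vertices
    against three components. The components need not contain paths, so edges run in thin
    neighbourhoods of them. Such a drawing keeps only edges without a common vertex apart, and the
    parity count is arranged to ask for no more. That [U] agrees with [W] away from the curves rests
    on [W] being the intersection of the sides of its boundary curves that contain it. This is where
    several disjoint discs together must not separate the sphere. *)

Lemma connected_split (C G H : set T) : connected C -> open G -> open H ->
  C `<=` G `|` H -> C `&` G `&` H = set0 -> C `&` G !=set0 -> C `<=` G.
Proof.
move=> cC oG oH CGH CGH0 CG0.
have E : C `&` G = C.
  apply: cC => //; first by exists G.
  exists (~` H); first exact: open_closedC.
  apply/seteqP; split=> x [Cx].
    by move=> Gx; split=> // Hx; rewrite -[False]/(set0 x) -CGH0.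
  by move=> nHx; split=> //; case: (CGH _ Cx).
by rewrite -E => x [].
Qed.

Lemma connected_componentP (A : set T) x y : connected_component A x y <->
  exists C, [/\ connected C, C `<=` A, C x & C y].
Proof. by split=> [[C [? ? ?] ?]|[C [? ? ? ?]]]; exists C. Qed.
End Tools.

Section Cont.
Context {R : realType} {T : topologicalType}.
Implicit Types (f g : T -> R) (x : T).

Lemma continuous_pair {U V : topologicalType} (f : T -> U) (g : T -> V) x :
  {for x, continuous f} -> {for x, continuous g} ->
  {for x, continuous (fun y => (f y, g y))}.
Proof. by move=> cf cg; apply: cvg_pair. Qed.

Lemma continuous_fst {U V : topologicalType} (f : T -> U * V) x :
  {for x, continuous f} -> {for x, continuous (fun y => (f y).1)}.
Proof. by move=> cf; apply: (cvg_comp _ _ cf); exact: cvg_fst. Qed.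

Lemma continuous_snd {U V : topologicalType} (f : T -> U * V) x :
  {for x, continuous f} -> {for x, continuous (fun y => (f y).2)}.
Proof. by move=> cf; apply: (cvg_comp _ _ cf); exact: cvg_snd. Qed.

Lemma continuous_add f g x : {for x, continuous f} -> {for x, continuous g} ->
  {for x, continuous (fun y => f y + g y)}.
Proof. exact: continuousD. Qed.

Lemma continuous_mul f g x : {for x, continuous f} -> {for x, continuous g} ->
  {for x, continuous (fun y => f y * g y)}.
Proof. exact: continuousM. Qed.

Lemma continuous_opp f x : {for x, continuous f} ->
  {for x, continuous (fun y => - f y)}.
Proof. exact: continuousN. Qed.

Lemma continuous_inv f x : f x != 0 -> {for x, continuous f} ->
  {for x, continuous (fun y => (f y)^-1)}.
Proof. exact: continuousV. Qed.

Lemma continuous_sqr f x : {for x, continuous f} ->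
  {for x, continuous (fun y => f y ^+ 2)}.
Proof. by move=> cf; exact: (continuous_mul cf cf). Qed.

Lemma continuous_cst {U : topologicalType} (k : U) x :
  {for x, continuous (fun _ : T => k)}.
Proof. exact: cst_continuous. Qed.

Lemma continuous_idfor x : {for x, continuous (fun y : T => y)}.
Proof. exact: cvg_id. Qed.

Lemma continuous_after {U V : topologicalType} (h : U -> V) (f : T -> U) x :
  {for f x, continuous h} -> {for x, continuous f} ->
  {for x, continuous (fun y => h (f y))}.
Proof. by move=> ch cf; exact: (@continuous_comp _ _ _ f h). Qed.

End Cont.

(** The recursion follows the arithmetic and pairing structure of the function; atoms are closed by
    [assumption], so the continuity of any other subterm has to be in the context beforehand. *)
Ltac cont1 :=
  try assumption;
  match goal with
  | |- context [continuous_at _ ?f] => lazymatch f with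
    | (fun y => y) => exact: continuous_idfor
    | (fun _ => ?c) => exact: continuous_cst
    | (fun y => (@?a y, @?b y)) => apply: (@continuous_pair _ _ _ a b)
    | (fun y => @?a y + @?b y) => apply: (@continuous_add _ _ a b)
    | (fun y => @?a y * @?b y) => apply: (@continuous_mul _ _ a b)
    | (fun y => @?a y ^+ 2) => apply: (@continuous_sqr _ _ a)
    | (fun y => - @?a y) => apply: (@continuous_opp _ _ a)
    | (fun y => (@?a y).1) => apply: (@continuous_fst _ _ _ a)
    | (fun y => (@?a y).2) => apply: (@continuous_snd _ _ _ a)
    end
  end.
Ltac cont := repeat cont1.

(** * Polar angles of plane vectors *)

Section Angle.
Context {R : realType}.
Implicit Types (u v w : R * R) (s t : R).

Definition polar v t := exists2 r, 0 < r & v = (r * cos t, r * sin t).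

Lemma polar_exists v : v <> (0, 0) -> exists t, polar v t.
Proof.
case: v => a b v0; pose r := Num.sqrt (a ^+ 2 + b ^+ 2).
have s0 : 0 < a ^+ 2 + b ^+ 2.
  rewrite lt_neqAle addr_ge0 ?sqr_ge0// andbT eq_sym paddr_eq0 ?sqr_ge0//.
  by apply/negP => /andP[]; rewrite !sqrf_eq0 => /eqP a0 /eqP b0; apply: v0; rewrite a0 b0.
have r0 : 0 < r by rewrite sqrtr_gt0.
have r2 : r ^+ 2 = a ^+ 2 + b ^+ 2 by rewrite sqr_sqrtr// ltW.
have ar : -1 <= a / r <= 1.
  rewrite ler_pdivlMr// ler_pdivrMr// mulN1r mul1r -ler_norml.
  by rewrite -(@ler_pXn2r _ 2)// ?nnegrE ?(ltW r0)// r2 real_normK ?num_real// lerDl sqr_ge0.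
have ar2 : (a / r) ^+ 2 <= 1.
  by rewrite expr_div_n ler_pdivrMr ?exprn_gt0// mul1r r2 lerDl sqr_ge0.
have E : r * Num.sqrt (1 - (a / r) ^+ 2) = `|b|.
  apply/eqP; rewrite -(@eqrXn2 _ 2)// ?mulr_ge0 ?sqrtr_ge0 ?ltW//.
  rewrite exprMn !sqr_sqrtr ?subr_ge0 ?(ltW s0)// expr_div_n r2 real_normK ?num_real//.
  by apply/eqP; field; rewrite gt_eqF.
have C : r * (a / r) = a by rewrite mulrC divfK ?gt_eqF.
have [b0|b0] := leP 0 b.
  exists (acos (a / r)), r => //; rewrite acosK ?in_itv//= sin_acos// E C ger0_norm//.
exists (- acos (a / r)), r => //; rewrite cosN sinN acosK ?in_itv//= sin_acos// mulrN E C ltr0_norm//.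
by rewrite opprK.
Qed.

Lemma cos1_2pi t : cos t = 1 -> exists n : int, t = 2 * pi * n%:~R.
Proof.
move=> ct; have p0 := @pi_gt0 R.
(* Subtracting whole turns leaves [0 <= s < 2 * pi]. Since [cos_inj] covers [[0, pi]], it is applied
   to [2 * pi - s] when [s] is larger. *)
pose n := Num.floor (t / (2 * pi)); exists n.
have p20 : 0 < 2 * pi :> R by rewrite mulr_gt0.
have := Num.Theory.floor_itv (t / (2 * pi)); rewrite -/n => /andP[].
rewrite ler_pdivlMr// ltr_pdivrMr// intrD => l1 l2.
set s := t - 2 * pi * n%:~R.
have cs : cos s = 1.
  have perm (m : nat) (x : R) : cos (x + 2 * pi * m%:R) = cos x.
    have -> : 2 * pi * m%:R = (pi *+ 2) *+ m :> R by rewrite -mulr_natr -(mulr_natr pi); ring.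
    exact: (periodicn (@cosD2pi R) m x).
  rewrite /s; case: (n) => m.
    by rewrite -pmulrn -(perm m) subrK.
  by rewrite NegzE mulrNz -pmulrn mulrN opprK perm.
have s0 : 0 <= s by rewrite /s; lra.
have s2 : s < 2 * pi by rewrite /s; lra.
suff : s = 0 by rewrite /s => /eqP; rewrite subr_eq0 => /eqP.
have i0 : (0 : R) \in `[0, pi] by rewrite in_itv /= lexx ltW.
have [sp|sp] := leP s pi.
  by apply: cos_inj; rewrite ?cos0// in_itv /= s0.
suff : 2 * pi - s = 0 by lra.
apply: cos_inj; rewrite ?cos0//; first by rewrite in_itv /=; apply/andP; split; lra.
have -> : 2 * pi - s = - s + pi *+ 2 by rewrite -mulr_natl; lra.
by rewrite cosD2pi cosN.
Qed.

Lemma polar_uniq v s t : polar v s -> polar v t ->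
  exists n : int, s - t = 2 * pi * n%:~R.
Proof.
move=> [r r0 ->] [q q0 [Ec Es]]; apply: cos1_2pi; rewrite cosB.
have rq : r = q.
  apply/eqP; rewrite -(@eqrXn2 _ 2)// ?ltW//; apply/eqP.
  have -> : r ^+ 2 = (r * cos s) ^+ 2 + (r * sin s) ^+ 2.
    by rewrite !exprMn -mulrDr cos2Dsin2 mulr1.
  by rewrite Ec Es !exprMn -mulrDr cos2Dsin2 mulr1.
have q1 : q != 0 by rewrite gt_eqF.
have {Ec}Ec : cos s = cos t by apply: (mulfI q1); rewrite -Ec rq.
have {Es}Es : sin s = sin t by apply: (mulfI q1); rewrite -Es rq.
by rewrite Ec Es -!expr2 cos2Dsin2.
Qed.

Lemma polarN v t : polar v t -> polar (- v) (t + pi).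
Proof.
move=> [r r0 ->]; exists r => //; rewrite cosDpi sinDpi.
by rewrite !mulrN; congr pair.
Qed.

Definition dot u v := u.1 * v.1 + u.2 * v.2.
(** The signed angle from [v] to [u] when it is acute: numerator and denominator are the product of
    the lengths times its sine and its cosine. *)
Definition turn u v := atan ((u.2 * v.1 - u.1 * v.2) / dot u v).

Lemma polar_turn u v t : polar v t -> 0 < dot u v -> polar u (t + turn u v).
Proof.
move=> [r r0 ->]; rewrite /turn /dot /=; set d := (X in 0 < X) => d0.
set c := (X in X / d).
have cs := cos2Dsin2 t.
set k := Num.sqrt (1 + (c / d) ^+ 2).
have k0 : 0 < k by rewrite sqrtr_gt0 ltr_pwDl// sqr_ge0.
have ca : cos (atan (c / d)) = k^-1 by rewrite cos_atan.
have sa : sin (atan (c / d)) = c / d / k.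
  have cn0 : cos (atan (c / d)) != 0 by rewrite ca invr_neq0// gt_eqF.
  by rewrite -[in RHS](atanK (c / d)) /tan -ca divfK.
(* The length of [u]: its component along [v] is [d / r], and the cosine of the turn is [1 / k]. *)
exists (d * k / r); first by rewrite divr_gt0// mulr_gt0.
rewrite cosD sinD ca sa.
have r1 : r != 0 by rewrite gt_eqF.
have d1 : d != 0 by rewrite gt_eqF.
have k1 : k != 0 by rewrite gt_eqF.
rewrite [u]surjective_pairing; congr pair.
  transitivity (d / r * cos t - c / r * sin t); last by field; rewrite r1 d1 k1.
  rewrite /d /c -[LHS]mulr1 -cs; field; exact: r1.
transitivity (d / r * sin t + c / r * cos t); last by field; rewrite r1 d1 k1.
rewrite /d /c -[LHS]mulr1 -cs; field; exact: r1.
Qed.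

End Angle.

(** * Continuous angles *)

Section Lift.
Context {R : realType}.
Implicit Types (v : R * R -> R * R).

Lemma turn_continuous {T : topologicalType} (f g : T -> R * R) x :
  {for x, continuous f} -> {for x, continuous g} -> 0 < dot (f x) (g x) ->
  {for x, continuous (fun y => turn (f y) (g y))}.
Proof.
move=> cf cg d0; rewrite /turn; apply: continuous_after; first exact: continuous_atan.
apply: continuous_mul; first by cont.
by apply: continuous_inv; [rewrite gt_eqF | rewrite /dot; cont].
Qed.

Lemma continuous_sum n {T : topologicalType} (F : nat -> T -> R) x :
  (forall k, (k < n)%N -> {for x, continuous (F k)}) ->
  {for x, continuous (fun y => \sum_(k < n) F k y)}.
Proof.
elim: n => [|n IH] cF.
  have -> : (fun y => \sum_(k < 0) F k y) = (fun=> 0).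
    by apply/funext => y; rewrite big_ord0.
  exact: continuous_cst.
have -> : (fun y => \sum_(k < n.+1) F k y) = (fun y => \sum_(k < n) F k y + F n y).
  by apply/funext => y; rewrite big_ord_recr.
by apply: continuous_add; [apply: IH => k kn; apply: cF; rewrite ltnS ltnW|exact: cF].
Qed.

(** The dot product is positive on the diagonal, hence near it, and compactness makes the radius
    uniform. The point [y] may leave [K]. *)
Lemma close_dot v (K : set (R * R)) : continuous v -> (forall x, v x <> (0, 0)) ->
  compact K -> exists2 d : R, 0 < d & forall x y : R * R, K x -> ball x d y -> 0 < dot (v y) (v x).
Proof.
move=> cv v0 /compact_near_coveringP cK.
have := cK R (0^'+) (fun d x => forall y, ball x d y -> 0 < dot (v y) (v x)) _.
case=> [x Kx|d /= d0 H].
  have cd : {for (x, x), continuous (fun p => dot (v p.1) (v p.2))}.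
    have c1 : {for (x, x), continuous (fun p : (R * R) * (R * R) => v p.1)}.
      by apply: continuous_after; [exact: cv | exact: cvg_fst].
    have c2 : {for (x, x), continuous (fun p : (R * R) * (R * R) => v p.2)}.
      by apply: continuous_after; [exact: cv | exact: cvg_snd].
    by rewrite /dot; cont.
  have d0 : 0 < dot (v x) (v x).
    rewrite /dot -!expr2 lt_neqAle addr_ge0 ?sqr_ge0// andbT eq_sym paddr_eq0 ?sqr_ge0//.
    apply/negP => /andP[]; rewrite !sqrf_eq0 => /eqP a0 /eqP b0; apply: (v0 x).
    by rewrite [v x]surjective_pairing a0 b0.
  have [[U V] /= [nU nV] UV] := cvgr_gt _ cd _ d0.
  have /nbhs_ballP[e /= e0 He'] : nbhs x (U `&` V) by exact: filterI.
  have He p : ball x e p.1 -> ball x e p.2 -> 0 < dot (v p.1) (v p.2).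
    by move=> /He'[Up _] /He'[_ Vp]; exact: (UV p).
  have e20 : 0 < e / 2 by rewrite divr_gt0.
  exists (ball x (e / 2), [set d | d < e / 2]) => /=.
    by split; [exact: nbhsx_ballx | exact: nbhs_right_lt].
  move=> [x' d] /= [bx' de] y bxy; apply: (He (y, x')) => /=.
    rewrite [e]splitr; apply: (ball_triangle bx'); apply: le_ball bxy; exact: ltW.
  by apply: le_ball bx'; rewrite ler_pdivrMr// mulr_natr mulr2n lerDl ltW.
exists (d / 2); first by rewrite divr_gt0.
move=> x y Kx bxy; apply: (H (d / 2)) => //=.
- by rewrite sub0r normrN gtr0_norm ?divr_gt0// ltr_pdivrMr// mulr_natr mulr2n ltrDl.
- by rewrite divr_gt0.
Qed.

Definition box (M : R) : set (R * R) := `[- M, M] `*` `[- M, M].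

Lemma box_compact M : compact (box M).
Proof. by apply: compact_setX; exact: segment_compact. Qed.

Definition scale2 (c : R) (x : R * R) : R * R := (c * x.1, c * x.2).

(* The angle is carried along each ray in [m] steps, so short that consecutive values of [v]
   form an acute angle. *)
Lemma lift_box v t0 M : continuous v -> (forall x, v x <> (0, 0)) -> polar (v (0, 0)) t0 ->
  exists th : R * R -> R, th (0, 0) = t0 /\
   forall x, box M x -> {for x, continuous th} /\ polar (v x) (th x).
Proof.
move=> cv v0 p0.
have [d d0 dH] := close_dot cv v0 (@box_compact M).
pose m := (Num.truncn (M / d)).+1.
have m0 : 0 < m%:R :> R by rewrite ltr0n.
have mM : M / m%:R < d by rewrite ltr_pdivrMr// mulrC -ltr_pdivrMr//; exact: truncnS_gt.
pose s (k : nat) (x : R * R) := scale2 (k%:R / m%:R) x.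
pose th x := t0 + \sum_(k < m) turn (v (s k.+1 x)) (v (s k x)).
have sbox k x : (k < m)%N -> box M x -> box M (s k x) /\ ball (s k x) d (s k.+1 x).
  move=> km [/=]; rewrite !in_itv/= -!ler_norml => x1 x2.
  have k01 : `|k%:R / m%:R| <= 1 :> R.
    by rewrite ger0_norm ?divr_ge0// ler_pdivrMr// mul1r ler_nat ltnW.
  split; first by split; rewrite /= in_itv /= -ler_norml normrM -[M]mul1r ler_pM.
  have E (a : R) : `|a| <= M -> `|k%:R / m%:R * a - k.+1%:R / m%:R * a| < d.
    move=> aM; have -> : k%:R / m%:R * a - k.+1%:R / m%:R * a = - (m%:R^-1 * a).
      by rewrite -natr1; ring.
    apply: le_lt_trans mM; rewrite normrN normrM ger0_norm ?invr_ge0// mulrC.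
    by rewrite ler_pM2r// invr_gt0.
  by split; rewrite /ball /=; exact: E.
have dots k x : (k < m)%N -> box M x -> 0 < dot (v (s k.+1 x)) (v (s k x)).
  by move=> km /(sbox _ _ km)[b1 b2]; exact: dH.
have cs k x : {for x, continuous (s k)} by rewrite /s /scale2; cont.
exists th; split.
  rewrite /th big1 ?addr0// => k _.
  rewrite /s /scale2 /= !mulr0 /turn; set a := v _.
  have -> : a.2 * a.1 - a.1 * a.2 = 0 by ring.
  by rewrite mul0r atan0.
move=> x bx; split.
  apply: continuous_add; first exact: continuous_cst.
  apply: (continuous_sum (F := fun k y => turn (v (s k.+1 y)) (v (s k y)))) => k km.
  apply: turn_continuous; last exact: dots.
  - by apply: continuous_after; [exact: cv | exact: cs].
  - by apply: continuous_after; [exact: cv | exact: cs].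
have : forall n, (n <= m)%N ->
    polar (v (s n x)) (t0 + \sum_(k < n) turn (v (s k.+1 x)) (v (s k x))).
  elim=> [_|n IH nm].
    by rewrite big_ord0 addr0 /s /scale2 !mul0r.
  rewrite big_ord_recr /= addrA; apply: polar_turn; first exact/IH/ltnW.
  exact: dots.
move/(_ m (leqnn m)); rewrite {1}/s divff ?gt_eqF// /scale2 !mul1r.
by rewrite -surjective_pairing.
Qed.

(** The image is an interval; if it contained two different multiples of [2 * pi], it would contain
    [h x + pi], which is none. *)
Lemma constant_mod_2pi {T : topologicalType} (C : set T) (h : T -> R) :
  connected C -> {within C, continuous h} ->
  (forall x, C x -> exists n : int, h x = 2 * pi * n%:~R) ->
  forall x y, C x -> C y -> h x = h y.
Proof.
move=> cC ch hn.
have /connected_intervalP I := connected_continuous_connected cC ch.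
have p0 := @pi_gt0 R.
suff H x y : C x -> C y -> h x < h y -> False.
  move=> x y Cx Cy; apply/eqP; rewrite eq_le !leNgt; apply/andP; split; apply/negP; exact: H.
move=> Cx Cy hxy.
have [n hx] := hn _ Cx; have [m hy] := hn _ Cy.
have nm : n < m.
  by move: hxy; rewrite hx hy ltr_pM2l ?mulr_gt0// ltr_int.
have nm1 : n%:~R + 1 <= m%:~R :> R by rewrite -[1]/(1%:~R) -intrD ler_int lezD1.
have [z Cz hz] : (h @` C) (h x + pi).
  apply: (I (h x) (h y)); [by exists x|by exists y|].
  rewrite lerDl ltW//= hx hy.
  have : 2 * pi * (n%:~R + 1) <= 2 * pi * m%:~R :> R by rewrite ler_pM2l// mulr_gt0.
  lra.
have [k] := hn _ Cz; rewrite hz hx => E.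
have /intr_inj : (n * 2 + 1)%:~R = (k * 2)%:~R :> R.
  apply: (mulfI (lt0r_neq0 p0)); rewrite !intrD !intrM; lra.
by lia.
Qed.

End Lift.

(** * A global angle on the plane, and Janiszewski's theorem *)

Section Jan.
Context {R : realType}.
Implicit Types (v : R * R -> R * R).

Lemma within_for {T U : topologicalType} (A : set T) (f : T -> U) :
  (forall x, A x -> {for x, continuous f}) -> {within A, continuous f}.
Proof. by move=> cf; apply: continuous_in_subspaceT => x /set_mem; exact: cf. Qed.

(** Along the segment from the origin to [x] two angles differ by a continuous multiple of [2 * pi].
    This makes the lifts on boxes of different sizes compatible. *)
Lemma ray_uniq v (th1 th2 : R * R -> R) M x :
  (forall x, box M x -> {for x, continuous th1} /\ polar (v x) (th1 x)) ->
  (forall x, box M x -> {for x, continuous th2} /\ polar (v x) (th2 x)) ->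
  th1 (0, 0) = th2 (0, 0) -> box M x -> th1 x = th2 x.
Proof.
move=> H1 H2 E0 [/=]; rewrite !in_itv /= -!ler_norml => x1 x2.
have bs (t : R) : [set` `[0, 1]] t -> box M (scale2 t x).
  rewrite /= in_itv /= => /andP[t0 t1]; split => /=; rewrite in_itv /= -ler_norml normrM;
  by rewrite -[M]mul1r ler_pM// ger0_norm.
pose g t := th1 (scale2 t x) - th2 (scale2 t x).
have cs t : {for t, continuous (fun t : R => scale2 t x)} by rewrite /scale2; cont.
have : g 0 = g 1.
  apply: (constant_mod_2pi (@segment_connected R 0 1)); rewrite /= ?in_itv /= ?lexx ?ler01//.
    apply: within_for => t /bs bt; apply: continuous_add.
      by apply: continuous_after; [exact: (H1 _ bt).1 | exact: cs].
    apply: continuous_opp; apply: continuous_after; last exact: cs.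
    exact: (H2 _ bt).1.
  by move=> t /bs bt; exact: polar_uniq (H1 _ bt).2 (H2 _ bt).2.
rewrite /g /scale2 !mul0r !mul1r E0 subrr -surjective_pairing => /esym/eqP.
by rewrite subr_eq0 => /eqP.
Qed.

Lemma boxP (M : R) x : box M x <-> `|x| <= M.
Proof.
rewrite prod_normE /= ge_max; split=> [[/=]|/andP[]].
  by rewrite !in_itv /= -!ler_norml => -> ->.
by split; rewrite /= in_itv /= -ler_norml.
Qed.

Lemma plane_lift v : continuous v -> (forall x, v x <> (0, 0)) ->
  exists2 th : R * R -> R, continuous th & forall x, polar (v x) (th x).
Proof.
move=> cv v0; have [t0 p0] := polar_exists (v0 (0, 0)).
have [th_ thP] := choice (fun n : nat => lift_box n%:R cv v0 p0).
(* The strict bound [|x| < N x] puts [x] in the interior of its box, so near [x] the glued angle is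
   the single lift [th_ (N x)], although [N] jumps. *)
pose N (x : R * R) := (Num.truncn `|x|).+1.
have xN x : `|x| < (N x)%:R by exact: truncnS_gt.
have agree n m x : (n <= m)%N -> `|x| <= n%:R -> th_ n x = th_ m x.
  move=> nm xn; apply: (ray_uniq (v := v) (M := n%:R)); first exact: (thP n).2.
  - by move=> y yn; apply: (thP m).2; move/boxP: yn => yn; apply/boxP/(le_trans yn); rewrite ler_nat.
  - by rewrite (thP n).1 (thP m).1.
  - exact/boxP.
exists (fun x => th_ (N x) x) => [x|x]; last first.
  by apply: ((thP (N x)).2 x _).2; apply/boxP/ltW.
have cx : {for x, continuous (th_ (N x))}.
  by apply: ((thP (N x)).2 x _).1; apply/boxP/ltW.
apply: cvg_trans cx; apply: near_eq_cvg.
have near_small : \forall y \near x, `|y| < (N x)%:R.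
  exact: (@cvgr_norm_lt _ _ _ (nbhs x) _ idfun x cvg_id _ (xN x)).
near=> y; apply/esym/agree; last exact/ltW/xN.
have : `|y| < (N x)%:R by near: y.
by move=> yx; rewrite /N truncn_lt_nat.
Unshelve. all: by end_near. Qed.

Lemma if_continuous {T U : topologicalType} (G H : set T) (f g : T -> U) x :
  open G -> open H -> G `&` H = set0 ->
  {for x, continuous f} -> {for x, continuous g} ->
  G x \/ H x \/ f x = g x ->
  {for x, continuous (fun y => if pselect (H y) then f y else g y)}.
Proof.
move=> oG oH GH cf cg [Gx|[Hx|fg]].
- have nH y : G y -> ~ H y by move=> Gy Hy; rewrite -[False]/(set0 y) -GH.
  rewrite /prop_for /continuous_at; case: (pselect (H x)) => [/(nH _ Gx)//|? /=].
  apply: cvg_trans cg; apply: near_eq_cvg.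
  apply: filterS (open_nbhs_nbhs (conj oG Gx)) => y /nH.
  by case: pselect.
- rewrite /prop_for /continuous_at; case: (pselect (H x)) => [? /=|//].
  apply: cvg_trans cf; apply: near_eq_cvg.
  by apply: filterS (open_nbhs_nbhs (conj oH Hx)) => y; case: pselect.
- rewrite /prop_for /continuous_at.
  have -> : (if pselect (H x) then f x else g x) = f x by case: pselect.
  move=> A nA; rewrite /nbhs /=.
  have nf := cf _ nA; have ng : nbhs x (g @^-1` A) by apply: cg; rewrite -fg.
  near=> y; rewrite /=; case: pselect => ? /=.
    by near: y.
  by near: y.
Unshelve. all: by end_near. Qed.

(* With [l] a Urysohn function equal to [0] on [X2] and to [1] on [X1], the map [v] equal to
   [exp (2 i pi l)] on [H] and to [1] elsewhere is continuous. If [th] is an angle of [v], then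
   [th - 2 pi l 1_H] is constant on [C1] and [th - 2 pi (l - 1) 1_H] is constant on [C2]. These
   two constants agree at [a] and differ by [2 pi] at [b]. *)
Lemma janiszewski_plane (X1 X2 C1 C2 G H : set (R * R)) a b :
  closed X1 -> closed X2 -> X1 `&` X2 = set0 ->
  connected C1 -> connected C2 -> C1 `&` X1 = set0 -> C2 `&` X2 = set0 ->
  open G -> open H -> G `&` H = set0 -> G `|` H = ~` (X1 `|` X2) ->
  C1 a -> C2 a -> G a -> C1 b -> C2 b -> H b -> False.
Proof.
move=> cX1 cX2 X12 cC1 cC2 CX1 CX2 oG oH GH GHX C1a C2a Ga C1b C2b Hb.
have disj (A B : set (R * R)) x : A `&` B = set0 -> A x -> B x -> False.
  by move=> AB Ax Bx; rewrite -[False]/(set0 x) -AB.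
have cover x : G x \/ H x \/ X1 x \/ X2 x.
  have [Xx|nX] := pselect ((X1 `|` X2) x); first by right; right.
  have [?|?] : (G `|` H) x by rewrite GHX.
    by left.
  by right; left.
have us : uniform_separator X2 X1.
  apply: normal_uniform_separator => //; last by rewrite setIC.
  exact: pseudometric_normal.
pose l : R * R -> R := Urysohn X2 X1.
have cl : continuous l := @Urysohn_continuous _ R X2 X1.
have l0 x : X2 x -> l x = 0 by move=> Xx; apply: (Urysohn_sub0 us); exists x.
have l1 x : X1 x -> l x = 1 by move=> Xx; apply: (Urysohn_sub1 us); exists x.
pose v x : R * R := if pselect (H x) then (cos (2 * pi * l x), sin (2 * pi * l x)) else (1, 0).
have cv : continuous v.
  move=> x; apply: (if_continuous oG oH GH).
  - have cx : {for x, continuous (fun y => 2 * pi * l y)} by have clx := cl x; cont.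
    by apply: continuous_pair; apply: continuous_after cx;
      [exact: continuous_cos|exact: continuous_sin].
  - exact: continuous_cst.
  - have [?|[?|[X|X]]] := cover x; [by left|by right; left| |]; right; right.
      by rewrite l1// mulr1 mulr_natl cos2pi sin2pi.
    by rewrite l0// mulr0 cos0 sin0.
have pv x : polar (v x) (if pselect (H x) then 2 * pi * l x else 0).
  by exists 1 => //; rewrite /v; case: pselect => ? /=; rewrite !mul1r ?cos0 ?sin0.
have v0 x : v x <> (0, 0).
  move=> E; have [r r0] := pv x; rewrite E => -[Ec Es].
  have := cos2Dsin2 (if pselect (H x) then 2 * pi * l x else 0).
  move/esym/eqP: Ec; move/esym/eqP: Es; rewrite !mulf_eq0 !(gt_eqF r0) /= => /eqP -> /eqP ->.
  by rewrite expr0n addr0 => /eqP; rewrite eq_sym oner_eq0.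
have [th cth pth] := plane_lift cv v0.
(* For integral [c] this is again an angle of [v]. Its jumps sit where [l] is 0 or 1; on a set
   missing [X1] the value [c = 0] removes them, on a set missing [X2] the value [c = 1]. *)
pose w (c : R) x := if pselect (H x) then 2 * pi * (l x - c) else 0.
have key (C : set (R * R)) (c : R) : (exists n : int, c = n%:~R) -> connected C ->
    (forall x, C x -> X1 x -> c = 1) -> (forall x, C x -> X2 x -> c = 0) ->
    C a -> C b -> th a = th b - 2 * pi * (l b - c).
  move=> [n cn] cC HX1 HX2 Ca Cb.
  have := constant_mod_2pi (h := fun x => th x - w c x) cC.
  have -> : th a = th a - w c a.
    by rewrite /w; case: pselect => [/(disj _ _ _ GH Ga)//|? /=]; rewrite subr0.
  have -> : th b - 2 * pi * (l b - c) = th b - w c b.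
    by rewrite /w; case: pselect.
  apply => //.
    apply: within_for => x Cx; apply: continuous_add; first exact: cth.
    apply: continuous_opp.
    apply: (if_continuous (f := fun y => 2 * pi * (l y - c)) (g := fun=> 0) oG oH GH).
    - by have clx := cl x; cont.
    - exact: continuous_cst.
    - have [?|[?|[X|X]]] := cover x; [by left|by right; left| |]; right; right.
        by rewrite l1// (HX1 x)// subrr mulr0.
      by rewrite l0// (HX2 x)// subrr mulr0.
  move=> x Cx; have [k E] := polar_uniq (pth x) (pv x).
  rewrite /w; move: E; case: pselect => Hx E.
    exists (k + n); rewrite intrD -cn [RHS]mulrDr -E /=; ring.
  by exists k; rewrite -E.
have k1 := key C1 0 (ex_intro _ 0 erefl) cC1.
have k2 := key C2 1 (ex_intro _ 1 erefl) cC2.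
have {}k1 : th a = th b - 2 * pi * (l b - 0).
  by apply: k1 => // x C1x X; case: (disj _ _ _ CX1 C1x X).
have {}k2 : th a = th b - 2 * pi * (l b - 1).
  by apply: k2 => // x C2x X; case: (disj _ _ _ CX2 C2x X).
have := @pi_gt0 R; move: k1 k2; set p := pi; set y := l b; move=> k1 k2 p0.
have : p * 2 = 0 by lra.
by move/eqP; rewrite mulf_eq0 gt_eqF//= pnatr_eq0.
Qed.

End Jan.

(** * The sphere *)

Section Stereo.
Context {R : realType}.
Implicit Types (e p q : pt R).
Local Notation S2 := (@S2 R).

(* The reflection exchanging [e] and [(0, 0, 1)]. If [e = (0, 0, 1)] it is the identity, because
   division by [0] gives [0]. *)
Definition refl e p : pt R :=
  let k := (p.1.1 * e.1.1 + p.1.2 * e.1.2 + p.2 * (e.2 - 1)) / (1 - e.2) in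
  (p.1.1 - k * e.1.1, p.1.2 - k * e.1.2, p.2 - k * (e.2 - 1)).

Definition ster p : R * R := (p.1.1 / (1 - p.2), p.1.2 / (1 - p.2)).

Definition unster (w : R * R) : pt R :=
  let q := w.1 ^+ 2 + w.2 ^+ 2 + 1 in
  (2 * w.1 / q, 2 * w.2 / q, (w.1 ^+ 2 + w.2 ^+ 2 - 1) / q).

Lemma sphere_pole e : S2 e -> e.2 = 1 -> e = (0, 0, 1).
Proof.
case: e => -[a b] c; rewrite /S2 /= => E c1.
have /eqP : a ^+ 2 + b ^+ 2 = 0 by rewrite c1 in E; lra.
rewrite c1 paddr_eq0 ?sqr_ge0//.
by rewrite !sqrf_eq0 => /andP[/eqP -> /eqP ->].
Qed.

Lemma reflK e p : S2 e -> refl e (refl e p) = p.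
Proof.
move=> Se; have [e1|ne1] := eqVneq e.2 1.
  rewrite (sphere_pole Se e1) /refl /= subrr invr0 !mulr0 !subr0.
  by case: p => -[].
have d0 : 1 - e.2 != 0 by rewrite subr_eq0 eq_sym.
case: e Se ne1 d0 => -[a b] c; case: p => -[x y] z; rewrite /S2 /refl /= => E _ d0.
have E' : a ^+ 2 = 1 - b ^+ 2 - c ^+ 2 by lra.
set k := (x * a + y * b + z * (c - 1)) / (1 - c).
have -> : ((x - k * a) * a + (y - k * b) * b + (z - k * (c - 1)) * (c - 1)) / (1 - c) = - k.
  have -> : (x - k * a) * a + (y - k * b) * b + (z - k * (c - 1)) * (c - 1) =
     (x * a + y * b + z * (c - 1)) - k * (a ^+ 2 + b ^+ 2 + (c - 1) ^+ 2) by ring.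
  rewrite E' /k; field; exact: d0.
by congr (_, _, _); ring.
Qed.

Lemma refl_S2 e p : S2 e -> S2 p -> S2 (refl e p).
Proof.
move=> Se Sp; have [e1|ne1] := eqVneq e.2 1.
  rewrite (sphere_pole Se e1) /refl /= subrr invr0 !mulr0 !subr0.
  by case: p Sp => -[].
have d0 : 1 - e.2 != 0 by rewrite subr_eq0 eq_sym.
case: e Se ne1 d0 => -[a b] c; case: p Sp => -[x y] z; rewrite /S2 /refl /= => Sp E _ d0.
have E' : a ^+ 2 = 1 - b ^+ 2 - c ^+ 2 by lra.
set k := (x * a + y * b + z * (c - 1)) / (1 - c).
have K : k * (1 - c) = x * a + y * b + z * (c - 1) by rewrite divfK.
transitivity (x ^+ 2 + y ^+ 2 + z ^+ 2 -
   2 * k * (x * a + y * b + z * (c - 1)) + k ^+ 2 * (a ^+ 2 + b ^+ 2 + (c - 1) ^+ 2)); first by ring.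
by rewrite -K E' Sp; ring.
Qed.

Lemma refl_pole e : S2 e -> refl e (0, 0, 1) = e.
Proof.
move=> Se; have [e1|ne1] := eqVneq e.2 1.
  by rewrite (sphere_pole Se e1) /refl /= subrr invr0 !mulr0 !subr0.
have d0 : 1 - e.2 != 0 by rewrite subr_eq0 eq_sym.
case: e Se ne1 d0 => -[a b] c /= Se _ d0.
by rewrite /refl /=; congr (_, _, _); field.
Qed.

Lemma unster_den (w : R * R) : w.1 ^+ 2 + w.2 ^+ 2 + 1 != 0.
Proof. by rewrite gt_eqF// ltr_wpDl// addr_ge0// sqr_ge0. Qed.

Lemma unsterK w : ster (unster w) = w.
Proof.
have q0 := unster_den w; case: w q0 => a b /= q0; rewrite /ster /unster /=.
have -> : 1 - (a ^+ 2 + b ^+ 2 - 1) / (a ^+ 2 + b ^+ 2 + 1) = 2 / (a ^+ 2 + b ^+ 2 + 1).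
  by field.
by congr pair; field; rewrite q0.
Qed.

Lemma unster_S2 w : S2 (unster w) /\ (unster w).2 != 1.
Proof.
have q0 := unster_den w; case: w q0 => a b /= q0; rewrite /S2 /unster /=; split.
  by field.
apply/eqP => /(congr1 ( *%R^~ (a ^+ 2 + b ^+ 2 + 1))); rewrite divfK// => E.
have : (1 + 1 : R) = 0 by lra.
by move/eqP; rewrite -mulr2n pnatr_eq0.
Qed.

Lemma sterK p : S2 p -> p.2 != 1 -> unster (ster p) = p.
Proof.
case: p => -[a b] c; rewrite /S2 /ster /unster /= => E c1.
have d0 : 1 - c != 0 by rewrite subr_eq0 eq_sym.
have -> : (a / (1 - c)) ^+ 2 + (b / (1 - c)) ^+ 2 = (1 + c) / (1 - c).
  have -> : (a / (1 - c)) ^+ 2 + (b / (1 - c)) ^+ 2 = (a ^+ 2 + b ^+ 2) / (1 - c) ^+ 2 by field.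
  have -> : a ^+ 2 + b ^+ 2 = (1 + c) * (1 - c) by lra.
  by field.
have -> : (1 + c) / (1 - c) + 1 = 2 / (1 - c) by field.
have -> : (1 + c) / (1 - c) - 1 = 2 * c / (1 - c) by field.
by congr (_, _, _); field; rewrite d0.
Qed.

(** A homeomorphism from the sphere without [e] onto the plane. The map [phi] is total on the
    ambient space, and its continuity at [p] is meant there, not only along the sphere. *)
Definition chart e (phi : pt R -> R * R) (psi : R * R -> pt R) :=
  [/\ continuous psi, forall w, S2 (psi w) /\ psi w <> e, forall w, phi (psi w) = w &
      forall p, S2 p -> p <> e -> psi (phi p) = p /\ {for p, continuous phi}].

Lemma refl_continuous e p : {for p, continuous (refl e)}.
Proof. by rewrite /refl; cont. Qed.

Lemma stereographic_chart e : S2 e -> exists phi psi, chart e phi psi.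
Proof.
move=> Se; exists (fun p => ster (refl e p)), (fun w => refl e (unster w)).
have pole p : S2 p -> p <> e -> (refl e p).2 != 1.
  move=> Sp pe; apply/eqP => /(sphere_pole (refl_S2 Se Sp)) E.
  by apply: pe; rewrite -(reflK p Se) E refl_pole.
split.
- move=> w; apply: (continuous_after (h := refl e) (f := unster)).
    exact: refl_continuous.
  have q0 := unster_den w; rewrite /unster /=.
  have c1 : {for w, continuous (fun w : R * R => (w.1 ^+ 2 + w.2 ^+ 2 + 1)^-1)}.
    by apply: continuous_inv => //; cont.
  by cont.
- move=> w; have [Sw w1] := unster_S2 w; split; first exact: refl_S2.
  move=> E; have : unster w = (0, 0, 1).
    by rewrite -(reflK (unster w) Se) E -{2}(refl_pole Se) reflK.
  by move=> Ew; move: w1; rewrite Ew eqxx.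
- by move=> w; rewrite reflK// unsterK.
- move=> p Sp pe; have z1 := pole _ Sp pe; split.
    by rewrite sterK ?reflK//; exact: refl_S2.
  apply: (continuous_after (h := ster) (f := refl e)); last exact: refl_continuous.
  set q := refl e p in z1 *.
  have c1 : {for q, continuous (fun q : pt R => (1 - q.2)^-1)}.
    by apply: continuous_inv; [rewrite subr_eq0 eq_sym | cont].
  by rewrite /ster; cont.
Qed.

End Stereo.

(** * Local topology of the sphere; Janiszewski's theorem on the sphere *)

Section SphereTop.
Context {R : realType}.
Implicit Types (e p q : pt R) (O W : set (pt R)).
Local Notation S2 := (@S2 R).

Lemma star_connected (A : set (R * R)) (c : R * R) : A c ->
  (forall x t, A x -> 0 <= t <= 1 -> A (c.1 + t * (x.1 - c.1), c.2 + t * (x.2 - c.2))) ->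
  connected A.
Proof.
move=> Ac star.
pose seg (x : R * R) (t : R) := (c.1 + t * (x.1 - c.1), c.2 + t * (x.2 - c.2)).
have -> : A = \bigcup_(x in A) (seg x @` `[0, 1]).
  apply/seteqP; split=> [x Ax|y [x Ax [t]]].
    exists x => //; exists 1; first by rewrite /= in_itv /= lexx ler01.
    by rewrite /seg !mul1r !subrKC -surjective_pairing.
  by rewrite /= in_itv /= => t01 <-; exact: star.
apply: bigcup_connected.
  exists c => x Ax; exists 0; first by rewrite /= in_itv /= lexx ler01.
  by rewrite /seg !mul0r !addr0 -surjective_pairing.
move=> x Ax; apply: connected_continuous_connected; first exact: segment_connected.
by apply: within_for => t _; rewrite /seg; cont.
Qed.

Lemma ball_connected (c : R * R) r : 0 < r -> connected (ball c r).
Proof.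
move=> r0; apply: (@star_connected _ c); first exact: ballxx.
move=> x t [b1 b2] /andP[t0 t1]; split; rewrite /ball /= opprD addrA subrr sub0r normrN.
  apply: le_lt_trans (_ : `|x.1 - c.1| < r); last by rewrite distrC.
  by rewrite normrM ger0_norm// ler_piMl.
apply: le_lt_trans (_ : `|x.2 - c.2| < r); last by rewrite distrC.
by rewrite normrM ger0_norm// ler_piMl.
Qed.

Lemma closed_S2 : closed S2.
Proof.
have -> : S2 = (fun p : pt R => p.1.1 ^+ 2 + p.1.2 ^+ 2 + p.2 ^+ 2) @^-1` [set 1] by [].
apply: preimage_closed; last exact: closed_eq.
by move=> p _; have : {for p, continuous (fun p : pt R => p.1.1 ^+ 2 + p.1.2 ^+ 2 + p.2 ^+ 2)} by cont.
Qed.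

Lemma sphere_openP W : W `<=` S2 ->
  (forall p, W p -> \forall q \near p, S2 q -> W q) -> sphere_open W.
Proof.
move=> WS H; exists (interior (W `|` ~` S2)); split; first exact: open_interior.
apply/seteqP; split=> [p Wp|p [/interior_subset[]//]].
split; last exact: WS.
by apply: filterS (H _ Wp) => q Wq; have [/Wq|] := pselect (S2 q); [left|right].
Qed.

Lemma sphere_open_sub W : sphere_open W -> W `<=` S2.
Proof. by move=> [V [_ ->]] p []. Qed.

Lemma sphere_open_near W p : sphere_open W -> W p -> \forall q \near p, S2 q -> W q.
Proof.
move=> [V [oO ->]] [Op _]; apply: filterS (open_nbhs_nbhs (conj oO Op)) => q Oq Sq.
by split.
Qed.

Lemma sphere_openD (X : set (pt R)) : closed X -> sphere_open (S2 `\` X).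
Proof.
move=> cX; exists (~` X); split; first exact: closed_openC.
by rewrite setIC.
Qed.

Lemma sphere_openI O W : sphere_open O -> sphere_open W -> sphere_open (O `&` W).
Proof.
move=> [V1 [h1 ->]] [V2 [h2 ->]]; exists (V1 `&` V2); split; first exact: openI.
by rewrite setIACA setIid.
Qed.

Lemma sphere_openU O W : sphere_open O -> sphere_open W -> sphere_open (O `|` W).
Proof.
move=> [V1 [h1 ->]] [V2 [h2 ->]]; exists (V1 `|` V2); split; first exact: openU.
by rewrite setIUl.
Qed.

Lemma closed_sphereD O : sphere_open O -> closed (S2 `\` O).
Proof.
move=> [U [oU ->]].
have -> : S2 `\` (U `&` S2) = S2 `&` ~` U.
  apply/seteqP; split=> p [Sp H]; split=> // Up; apply: H => //.
  by case: Up.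
by apply: closedI; [exact: closed_S2|exact: open_closedC].
Qed.

Lemma sphere_connected_split (C G H : set (pt R)) : connected C -> C `<=` S2 ->
  sphere_open G -> sphere_open H -> C `<=` G `|` H -> G `&` H = set0 ->
  C `&` G !=set0 -> C `<=` G.
Proof.
move=> cC CS [G' [oG EG]] [H' [oH EH]] CGH GH [p [Cp Gp]].
have CG : C `<=` G'.
  apply: (connected_split cC oG oH).
  - by move=> q /CGH; rewrite EG EH => -[[]|[]]; [left|right].
  - apply/seteqP; split=> // q [[Cq Gq] Hq]; rewrite -GH EG EH; split; split=> //; exact: CS.
  - by exists p; split=> //; move: Gp; rewrite EG => -[].
by move=> q Cq; rewrite EG; split; [exact: CG|exact: CS].
Qed.

(** Projecting from the antipode gives a chart around any prescribed point. *)
Lemma antipode q : S2 q -> S2 (- q) /\ q <> - q.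
Proof.
case: q => -[a b] c; rewrite /S2 /= => E; split; first by rewrite !sqrrN.
case=> E1 E2 E3; have a0 : a = 0 by lra. have b0 : b = 0 by lra. have c0 : c = 0 by lra.
by move: E; rewrite a0 b0 c0 expr0n /= !addr0 => /eqP; rewrite eq_sym oner_eq0.
Qed.

Lemma chart_open e phi psi W : chart e phi psi -> sphere_open W -> open (psi @^-1` W).
Proof.
move=> [cpsi psiS _ _] [V [oO ->]].
have -> : psi @^-1` (V `&` S2) = psi @^-1` V.
  by apply/seteqP; split=> [w []//|w Vw]; split=> //; exact: (psiS w).1.
by apply: open_comp => // w _; exact: cpsi.
Qed.

Lemma neq_near {T : topologicalType} (p e : T) : hausdorff_space T -> p <> e ->
  \forall q \near p, q <> e.
Proof.
move=> hT pe; have : open (~` [set e]) by apply/closed_openC/accessible_closed_set1/hausdorff_accessible.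
by move=> oe; apply: filterS (open_nbhs_nbhs (conj oe pe)) => q.
Qed.

Lemma hausdorff_pt : hausdorff_space (pt R).
Proof. exact: norm_hausdorff. Qed.

Lemma sphere_locally_connected O p : sphere_open O -> O p ->
  \forall q \near p, S2 q -> connected_component O p q.
Proof.
move=> oO Op; have Sp := sphere_open_sub oO Op.
have [Se pe] := antipode Sp; have [phi [psi ch]] := stereographic_chart Se.
have oP := chart_open ch oO; case: ch => cpsi psiS phiK psiK.
have [Ep cp] := psiK _ Sp pe.
have : nbhs (phi p) (psi @^-1` O) by apply: open_nbhs_nbhs; split=> //=; rewrite Ep.
move=> /nbhs_ballP[r /= r0 br].
have nb : \forall q \near p, ball (phi p) r (phi q) by apply: cp; exact: nbhsx_ballx.
have ne := neq_near hausdorff_pt pe.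
near=> q => Sq; apply/connected_componentP; exists (psi @` ball (phi p) r); split.
- apply: connected_continuous_connected; first exact: ball_connected.
  by apply: within_for => w _; exact: cpsi.
- by move=> _ [w bw <-]; exact: br.
- by exists (phi p) => //; exact: ballxx.
- have qe : q <> - p by near: q.
  by exists (phi q); [near: q|exact: (psiK q Sq qe).1].
Unshelve. all: by end_near. Qed.

Lemma component_sphere_open O p : sphere_open O -> sphere_open (connected_component O p).
Proof.
move=> oO; apply: sphere_openP.
  by move=> q /connected_component_sub; exact: sphere_open_sub.
move=> q Cq; have Oq := connected_component_sub Cq.
apply: filterS (sphere_locally_connected oO Oq) => z + Sz => /(_ Sz).
exact: connected_component_trans.
Qed.

Lemma cocomponent_sphere_open O p : sphere_open O ->
  sphere_open (O `\` connected_component O p).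
Proof.
move=> oO; apply: sphere_openP.
  by move=> q [Oq _]; exact: sphere_open_sub Oq.
move=> q [Oq nq]; apply: filterS (sphere_locally_connected oO Oq) => z + Sz => /(_ Sz) qz.
split; first exact: connected_component_sub qz.
by move=> pz; apply: nq; apply: connected_component_trans pz (connected_component_sym qz).
Qed.

(** In a chart, a punctured disc is the image under polar coordinates of the strip [0 < w.1 < r],
    which is convex. *)
Lemma punctured_nbhs O o : sphere_open O -> O o ->
  exists Q, [/\ connected Q, Q `<=` O `\ o & \forall q \near o, S2 q -> q <> o -> Q q].
Proof.
move=> oO Oo; have So := sphere_open_sub oO Oo.
have [Se oe] := antipode So; have [phi [psi ch]] := stereographic_chart Se.
have oP := chart_open ch oO; case: ch => cpsi psiS phiK psiK.
have [Eo co] := psiK _ So oe.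
have : nbhs (phi o) (psi @^-1` O) by apply: open_nbhs_nbhs; split=> //=; rewrite Eo.
move=> /nbhs_ballP[r /= r0 br].
set c := phi o in co br Eo *.
pose h (w : R * R) := psi (c.1 + w.1 * cos w.2, c.2 + w.1 * sin w.2).
pose A : set (R * R) := [set w | 0 < w.1 < r].
have ch : continuous h.
  move=> w.
  suff : {for w, continuous (fun w : R * R => (c.1 + w.1 * cos w.2, c.2 + w.1 * sin w.2))}.
    by move=> cf; exact: (continuous_after (cpsi _) cf).
  have c1 : {for w, continuous (fun w : R * R => cos w.2)}.
    by apply: continuous_after; [exact: continuous_cos | exact: cvg_snd].
  have c2 : {for w, continuous (fun w : R * R => sin w.2)}.
    by apply: continuous_after; [exact: continuous_sin | exact: cvg_snd].
  by cont.
exists (h @` A); split.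
- apply: connected_continuous_connected; last by apply: within_for => w _; exact: ch.
  apply: (@star_connected _ (r / 2, 0)); rewrite /A /=; first by apply/andP; split; lra.
  move=> [s u] t /= /andP[s0 sr] /andP[t0 t1]; apply/andP; split; nra.
- move=> _ [[s u] /= /andP[s0 sr] <-]; split; rewrite /h /=.
    apply: br; split; rewrite /ball /= opprD addrA subrr sub0r normrN normrM gtr0_norm//.
      by apply: le_lt_trans sr; rewrite ler_piMr ?(ltW s0)// cos_max.
    by apply: le_lt_trans sr; rewrite ler_piMr ?(ltW s0)// sin_max.
  move=> /(congr1 phi); rewrite phiK -/c => E.
  have z1 : s * cos u = 0 by have /= := congr1 fst E; lra.
  have z2 : s * sin u = 0 by have /= := congr1 snd E; lra.
  have : s ^+ 2 = (s * cos u) ^+ 2 + (s * sin u) ^+ 2.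
    by rewrite !exprMn -mulrDr cos2Dsin2 mulr1.
  by rewrite z1 z2 expr0n addr0 => /eqP; rewrite sqrf_eq0 gt_eqF.
(* Balls are for the maximum norm: coordinates below [r / 2] bound the squared Euclidean length by
   [r ^+ 2 / 2], less than [r ^+ 2]. *)
have r20 : 0 < r / 2 by rewrite divr_gt0.
have nb : \forall q \near o, ball c (r / 2) (phi q) by apply: co; exact: nbhsx_ballx.
have ne := neq_near hausdorff_pt oe.
near=> q => Sq qo.
have qe : q <> - o by near: q.
have [Eq _] := psiK _ Sq qe.
have bq : ball c (r / 2) (phi q) by near: q.
have d0 : phi q - c <> (0, 0).
  by move/eqP; rewrite subr_eq0 => /eqP E; apply: qo; rewrite -Eq E.
have [t [s s0 E]] := polar_exists d0.
exists (s, t) => /=.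
  rewrite /A /= s0 /=; case: bq; rewrite /ball /=.
  move: E; rewrite [phi q - c]surjective_pairing => -[/= E1 E2].
  rewrite distrC E1 distrC E2 => b1 b2.
  have : s ^+ 2 < r ^+ 2; last by rewrite ltr_pXn2r// nnegrE ltW.
  have -> : s ^+ 2 = (s * cos t) ^+ 2 + (s * sin t) ^+ 2.
    by rewrite !exprMn -mulrDr cos2Dsin2 mulr1.
  have sq (x : R) : `|x| < r / 2 -> x ^+ 2 <= (r / 2) ^+ 2.
    by move=> xr; rewrite -[x ^+ 2]real_normK ?num_real// ler_pXn2r ?nnegrE// ltW.
  have := sq _ b1; have := sq _ b2.
  have : 0 < r ^+ 2 by rewrite exprn_gt0.
  rewrite expr_div_n; lra.
rewrite /h -Eq; congr psi.
move: E; rewrite [phi q]surjective_pairing => -[/= <- <-].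
by rewrite !subrKC.
Unshelve. all: by end_near. Qed.

(** If a component [M] of the punctured set left out a part [N], the connected punctured
    neighbourhood [Q] of [o] would lie in one of the two. Adding [o] to that one keeps it open and
    would split [O]. *)
Lemma punctured_connected O o : sphere_open O -> connected O -> connected (O `\ o).
Proof.
move=> oO cO; have [Oo|nOo] := pselect (O o); last first.
  suff -> : O `\ o = O by [].
  by apply/seteqP; split=> [p []//|p Op]; split=> // po; apply: nOo; rewrite -po.
have oO' : sphere_open (O `\ o).
  have -> : O `\ o = O `&` (S2 `\ o).
    apply/seteqP; split=> [p [Op po]|p [Op [_ po]]]; split=> //; split=> //.
    exact: sphere_open_sub Op.
  apply: sphere_openI => //; apply: sphere_openD.
  exact/accessible_closed_set1/hausdorff_accessible/hausdorff_pt.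
have [->|/set0P[a Oa]] := eqVneq (O `\ o) set0; first exact: connected0.
have oM := component_sphere_open a oO'; have oN := cocomponent_sphere_open a oO'.
set M := connected_component _ _ in oM oN; set N := _ `\` M in oN.
suff -> : O `\ o = M by exact: component_connected.
apply/seteqP; split; last exact: connected_component_sub.
move=> b Ob; apply: contrapT => nMb.
have Nb : N b by split.
have Ma : M a by exact: connected_component_refl.
have [Q [cQ QO nQ]] := punctured_nbhs oO Oo.
have So := sphere_open_sub oO Oo.
have ext (Y : set (pt R)) : sphere_open Y -> Q `<=` Y -> sphere_open (Y `|` [set o]).
  move=> oY QY; apply: sphere_openP => [p [/(sphere_open_sub oY)//|->//]|p [Yp|->]].
    by apply: filterS (sphere_open_near oY Yp) => q H /H; left.
  apply: filterS nQ => q Hq Sq; have [->|qo] := pselect (q = o); first by right.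
  by left; apply: QY; exact: Hq.
have noM : ~ M o by move=> /connected_component_sub[_ h]; exact: h.
have noN : ~ N o by move=> [[_ h] _]; exact: h.
have MN (q : pt R) : M q -> N q -> False by move=> Mq [].
have OMN (q : pt R) : O q -> q <> o -> M q \/ N q.
  by move=> Oq qo; have [|] := pselect (M q); [left|right].
have [[z [Qz Mz]]|QM] := pselect (Q `&` M !=set0).
  have QM : Q `<=` M.
    move=> q Qq; apply: connected_component_trans Mz _.
    by apply/connected_componentP; exists Q; split.
  have : O `<=` M `|` [set o].
    apply: (sphere_connected_split (H := N) cO (sphere_open_sub oO)) => //.
    - exact: ext.
    - move=> q Oq; have [->|qo] := pselect (q = o); first by left; right.
      by have [|] := OMN q Oq qo; [left; left|right].
    - by apply/seteqP; split=> // q [[|->//]]; exact: MN.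
    - by exists o; split=> //; right.
  by move/(_ b Ob.1) => [//|bo]; apply: Ob.2.
have QN : Q `<=` N.
  by move=> q Qq; split; [exact: QO|move=> Mq; apply: QM; exists q].
have : O `<=` N `|` [set o].
  apply: (sphere_connected_split (H := M) cO (sphere_open_sub oO)) => //.
  - exact: ext.
  - move=> q Oq; have [->|qo] := pselect (q = o); first by left; right.
    by have [|] := OMN q Oq qo; [right|left; left].
  - by apply/seteqP; split=> // q [[Nq|->//] Mq]; exact: (MN q).
  - by exists o; split=> //; right.
by move/(_ a Oa.1) => [[]//|ao]; apply: Oa.2.
Qed.

(** Projection from [o] sends the only possible common point of [X1] and [X2] to infinity, so that
    their planar traces are disjoint closed sets. Both one common point and disjoint sets are
    covered. The component of [a] and the rest of the complement play the roles of [G] and [H]. *)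
Lemma janiszewski_sphere (X1 X2 C1 C2 : set (pt R)) o a b :
  closed X1 -> closed X2 -> (X1 `|` X2) o -> S2 o -> X1 `&` X2 `<=` [set o] ->
  connected C1 -> connected C2 -> C1 `<=` S2 `\` X1 -> C2 `<=` S2 `\` X2 ->
  ~ C1 o -> ~ C2 o -> C1 a -> C1 b -> C2 a -> C2 b ->
  connected_component (S2 `\` (X1 `|` X2)) a b.
Proof.
move=> cX1 cX2 Xo So X12 cC1 cC2 CX1 CX2 nC1 nC2 C1a C1b C2a C2b.
apply: contrapT => nab.
have [phi [psi ch]] := stereographic_chart So.
have oX : sphere_open (S2 `\` (X1 `|` X2)) by apply: sphere_openD; exact: closedU.
have [Sa _] := CX1 _ C1a.
have Xa : (S2 `\` (X1 `|` X2)) a.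
  by split=> // -[Xa|Xa]; [case: (CX1 _ C1a)|case: (CX2 _ C2a)].
have Xb : (S2 `\` (X1 `|` X2)) b.
  by split=> [|[Xb|Xb]]; [case: (CX1 _ C1b)|case: (CX1 _ C1b)|case: (CX2 _ C2b)].
have oG := component_sphere_open a oX; have oH := cocomponent_sphere_open a oX.
have oG' := chart_open ch oG; have oH' := chart_open ch oH.
case: ch => cpsi psiS phiK psiK.
have cpre (X : set (pt R)) : closed X -> closed (psi @^-1` X).
  by move=> cX; apply: preimage_closed => // w _; exact: cpsi.
have neo (C X : set (pt R)) : C `<=` S2 `\` X -> ~ C o -> forall p, C p -> S2 p /\ p <> o.
  by move=> CX nC p Cp; split; [case: (CX _ Cp)|move=> po; apply: nC; rewrite -po].
have cim (C X : set (pt R)) : connected C -> C `<=` S2 `\` X -> ~ C o -> connected (phi @` C).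
  move=> cC CX nC; apply: connected_continuous_connected => //.
  by apply: within_for => p /(neo _ _ CX nC)[Sp po]; exact: (psiK _ Sp po).2.
have dim (C X : set (pt R)) : C `<=` S2 `\` X -> ~ C o -> phi @` C `&` psi @^-1` X = set0.
  move=> CX nC; apply/seteqP; split=> // w [[p Cp <-]] /=.
  by have [Sp po] := neo _ _ CX nC _ Cp; rewrite (psiK _ Sp po).1; case: (CX _ Cp).
have [_ ao] := neo _ _ CX1 nC1 _ C1a; have [Sb bo] := neo _ _ CX1 nC1 _ C1b.
apply: (@janiszewski_plane R (psi @^-1` X1) (psi @^-1` X2) (phi @` C1) (phi @` C2) _ _ (phi a) (phi b)
  _ _ _ _ _ _ _ oG' oH').
- exact: cpre.
- exact: cpre.
- by apply/seteqP; split=> // w /X12 /= E; have := (psiS w).2.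
- exact: cim cC1 CX1 nC1.
- exact: cim cC2 CX2 nC2.
- exact: dim.
- exact: dim.
- by apply/seteqP; split=> // w [] /= ? [].
- apply/seteqP; split=> w /=.
    by move=> [/connected_component_sub[]|[[]]].
  move=> nX; have Xw : (S2 `\` (X1 `|` X2)) (psi w) by split=> //; exact: (psiS w).1.
  by have [|] := pselect (connected_component (S2 `\` (X1 `|` X2)) a (psi w)); [left|right].
- by exists a.
- by exists a.
- by rewrite /= (psiK _ Sa ao).1; exact: connected_component_refl.
- by exists b.
- by exists b.
- by rewrite /= (psiK _ Sb bo).1; split.
Qed.

End SphereTop.

(** * Arcs and simple closed curves *)

Section Arcs.
Context {R : realType}.
Implicit Types (e p q a b : pt R) (F : R -> pt R) (s t u v : R).
Local Notation S2 := (@S2 R).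

(* This is [min (max t 0) 1]. *)
Definition clamp t : R := (`|t| - `|t - 1| + 1) / 2.

Lemma clamp_continuous : continuous clamp.
Proof.
move=> t; rewrite /clamp.
have c1 : {for t, continuous (fun t : R => `|t|)}.
  by apply: (continuous_after (f := idfun)); [exact: norm_continuous|exact: cvg_id].
have c2 : {for t, continuous (fun t : R => `|t - 1|)}.
  by apply: (continuous_after (f := fun t => t - 1)); [exact: norm_continuous|cont].
by have : {for t, continuous (fun t => (`|t| - `|t - 1| + 1) / 2)} by cont.
Qed.

Lemma clamp_itv t : 0 <= clamp t <= 1.
Proof.
by rewrite /clamp; have [t0|t0] := ger0P t; have [t1|t1] := ger0P (t - 1);
  apply/andP; split; lra.
Qed.

Lemma clamp_id t : 0 <= t <= 1 -> clamp t = t.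
Proof.
by move=> /andP[t0 t1]; rewrite /clamp ger0_norm// ler0_norm; lra.
Qed.

Lemma continuous_clamped {U V : topologicalType} (A : set U) (f : U -> V)
    {T : topologicalType} (c : T -> U) :
  {within A, continuous f} -> continuous c -> (forall x, A (c x)) ->
  continuous (fun x => f (c x)).
Proof.
move=> /subspace_continuousP cf cc Ac x.
apply: (@cvg_comp _ _ _ c f (nbhs x) (within A (nbhs (c x)))); last exact: cf.
move=> B nB; have H : nbhs x (fun y => A (c y) -> B (c y)) := cc x _ nB.
suff : nbhs x (c @^-1` B) by [].
by apply: filterS H => y; apply; exact: Ac.
Qed.

(** With a periodic parametrisation every subarc, wherever it starts, is the image of an interval;
    injectivity then concerns parameters less than one period apart. *)
Definition loop_param {T : topologicalType} (F : R -> T) (J : set T) :=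
  [/\ continuous F, forall t, F (t + 1) = F t,
      forall s t, `|s - t| < 1 -> F s = F t -> s = t & J = range F].

(** The parametrisation is [f] at the fractional part of [t]. Off the integers the floor is locally
    constant; at an integer the left and right pieces match because [f 0 = f 1]. Clamping first
    makes [f] continuous on the whole line. *)
Lemma loop_paramP (J : set (pt R)) : simple_closed_curve J ->
  J `<=` S2 /\ exists F, loop_param F J.
Proof.
move=> [JS [f [cf [f01 [finj EJ]]]]]; split=> //; rewrite {}EJ.
have cg : continuous (fun t => f (clamp t)).
  by apply: (continuous_clamped cf clamp_continuous) => t; exact: clamp_itv.
set g := (fun t => f (clamp t)) in cg.
have gf t : 0 <= t <= 1 -> g t = f t by move=> t01; rewrite /g clamp_id.
pose fl t : R := (Num.floor t)%:~R.
have flP t : fl t <= t < fl t + 1.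
  by have := Num.Theory.floor_itv t; rewrite intrD.
have fr t : 0 <= t - fl t <= 1 by have /andP[] := flP t => ? ?; apply/andP; split; lra.
have fl_eq (n : int) t : n%:~R <= t < n%:~R + 1 -> fl t = n%:~R.
  by move=> tn; congr (_%:~R); apply/Num.Theory.floor_def; rewrite intrD.
exists (fun t => g (t - fl t)); split.
- move=> t; pose n := Num.floor t; have /andP[nt tn] := flP t.
  have csh (c : R) : {for t, continuous (fun s => g (s - c))}.
    by apply: continuous_after; [exact: cg|cont].
  have [tn0|ltn] := eqVneq (fl t) t; last first.
    have nt' : fl t < t by rewrite lt_neqAle ltn nt.
    apply: cvg_trans (csh (fl t)); apply: near_eq_cvg; near=> s.
    rewrite (fl_eq n s)//; apply/andP; split; near: s.
      by apply: filterS (lt_nbhsr nt') => s /ltW.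
    exact: lt_nbhsl.
  pose H : set R := [set s | s < fl t].
  have cc : {for t, continuous (fun s => if pselect (H s) then g (s - (fl t - 1)) else g (s - fl t))}.
    have oH : open H by exact: open_lt.
    apply: (if_continuous open0 oH (set0I _) (csh (fl t - 1)) (csh (fl t))).
    by right; right; rewrite tn0 subrr opprB subrKC !gf ?lexx ?ler01.
  have E s : fl t - 1 <= s < fl t + 1 ->
      g (s - fl s) = if pselect (H s) then g (s - (fl t - 1)) else g (s - fl t).
    move=> /andP[s1 s2]; case: pselect => sn /=.
      rewrite (fl_eq (n - 1) s) intrD mulrN1z//; apply/andP; split; first exact: s1.
      by rewrite subrK.
    rewrite (fl_eq n s)//; apply/andP; split; last exact: s2.
    by rewrite leNgt; apply/negP.
  rewrite /continuous_at E; last by apply/andP; split; lra.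
  apply: cvg_trans cc; apply: near_eq_cvg; near=> s.
  rewrite E//; apply/andP; split; near: s; last exact: lt_nbhsl.
  have t1 : fl t - 1 < t by lra.
  by apply: filterS (lt_nbhsr t1) => s /ltW.
- move=> t; have -> : fl (t + 1) = fl t + 1; last by rewrite opprD addrACA subrr addr0.
  have /andP[? ?] := flP t.
  have := (fl_eq (Num.floor t + 1) (t + 1)); rewrite intrD; apply; apply/andP; split; lra.
- move=> s t st; rewrite !gf// => E.
  have {}E : s - fl s = t - fl t.
    apply: finj => //.
      by have /andP[? ?] := flP s; apply/andP; split; lra.
    by have /andP[? ?] := flP t; apply/andP; split; lra.
  have E' : s - t = (Num.floor s - Num.floor t)%:~R by rewrite intrB -/(fl s) -/(fl t); lra.
  move: st; rewrite E' -intr_norm -[1]/(1%:~R) ltr_int => n1.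
  have n0 : Num.floor s - Num.floor t = 0 by move: n1; lia.
  by move: E'; rewrite n0 => /eqP; rewrite subr_eq0 => /eqP.
- apply/seteqP; split=> [_ [t /andP[t0 t1] <-]|_ [t _ <-]]; last first.
    by exists (t - fl t); [exact: fr|rewrite gf].
  have [t1'|t1'] := ltP t 1.
    exists t => //; rewrite (fl_eq 0 t); last by rewrite add0r t0.
    by rewrite subr0 gf// t0.
  have -> : t = 1 by lra.
  exists 0 => //; rewrite (fl_eq 0 0); last by rewrite add0r lexx ltr01.
  by rewrite subrr gf// lexx ler01.
Unshelve. all: by end_near. Qed.

Lemma loop_shift {T : topologicalType} (F : R -> T) J (r t : R) : loop_param F J ->
  exists t', r <= t' < r + 1 /\ F t' = F t.
Proof.
move=> [_ Fper _ _].
have Fpern (k : nat) s : F (s + k%:R) = F s.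
  by elim: k s => [|k IH] s; rewrite ?addr0// -natr1 addrA Fper.
have Fperz (n : int) s : F (s - n%:~R) = F s.
  case: n => k; last by rewrite NegzE mulrNz opprK -pmulrn Fpern.
  by rewrite -pmulrn -[LHS](Fpern k) subrK.
have /andP[f1 f2] := Num.Theory.floor_itv (t - r); rewrite intrD in f2.
by exists (t - (Num.floor (t - r))%:~R); split; [apply/andP; split; lra|].
Qed.

Lemma joining_compact e a b : S2 e -> S2 a -> S2 b -> a <> e -> b <> e ->
  exists D, [/\ compact D, connected D, D `<=` S2 `\ e, D a & D b].
Proof.
move=> Se Sa Sb ae be; have [phi [psi [cpsi psiS phiK psiK]]] := stereographic_chart Se.
pose g t := psi ((phi a).1 + t * ((phi b).1 - (phi a).1), (phi a).2 + t * ((phi b).2 - (phi a).2)).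
have cg : continuous g.
  move=> t.
  suff : {for t, continuous (fun t : R => ((phi a).1 + t * ((phi b).1 - (phi a).1), (phi a).2 + t * ((phi b).2 - (phi a).2)))}.
    by move=> cf; exact: (continuous_after (cpsi _) cf).
  by cont.
have wcg : {within `[0, 1], continuous g} by apply: within_for => t _; exact: cg.
exists (g @` `[0, 1]); split.
- by apply: continuous_compact => //; exact: segment_compact.
- by apply: connected_continuous_connected => //; exact: segment_connected.
- by move=> _ [t _ <-]; exact: psiS.
- exists 0; first by rewrite /= in_itv /= lexx ler01.
  by rewrite /g !mul0r !addr0 -surjective_pairing (psiK _ Sa ae).1.
- exists 1; first by rewrite /= in_itv /= lexx ler01.
  by rewrite /g !mul1r !subrKC -surjective_pairing (psiK _ Sb be).1.
Qed.

Lemma closed_arc F u v : continuous F -> closed (F @` `[u, v]).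
Proof.
move=> cF; apply: compact_closed; first exact: hausdorff_pt.
apply: continuous_compact; last exact: segment_compact.
by apply: within_for => t _; exact: cF.
Qed.

(* The initial subarcs that do not separate [a] from [b] extend past the supremum [m] of their
   endpoints, by Janiszewski's theorem for two arcs with one common point. *)
Lemma arc_does_not_separate F u v a b : continuous F -> (forall t, S2 (F t)) -> u <= v ->
  (forall s t, u <= s <= v -> u <= t <= v -> F s = F t -> s = t) ->
  (S2 `\` F @` `[u, v]) a -> (S2 `\` F @` `[u, v]) b ->
  connected_component (S2 `\` F @` `[u, v]) a b.
Proof.
move=> cF SF uv Finj Ha Hb.
pose T : set R := [set w | u <= w <= v /\ connected_component (S2 `\` F @` `[u, w]) a b].
have nF c w : (S2 `\` F @` `[u, v]) c -> u <= w <= v -> c <> F w.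
  by move=> [_ nc] wuv E; apply: nc; exists w => //; rewrite /= in_itv.
have Tu : T u.
  split; first by rewrite lexx.
  have uuv : u <= u <= v by rewrite lexx.
  have [D [_ cD DS Da Db]] := joining_compact (SF u) Ha.1 Hb.1 (nF _ _ Ha uuv) (nF _ _ Hb uuv).
  apply/connected_componentP; exists D; split => // q /DS[Sq qu]; split=> // -[w].
  by rewrite /= in_itv /= -eq_le => /eqP <- /esym.
have hT : has_sup T by split; [exists u|exists v => w [/andP[]]].
pose m := sup T.
have um : u <= m by exact: sup_upper_bound hT _ Tu.
have mv : m <= v by apply: ge_sup; [exists u|move=> w [/andP[]]].
have muv : u <= m <= v by rewrite um.
have [D [kD cD DS Da Db]] := joining_compact (SF m) Ha.1 Hb.1 (nF _ _ Ha muv) (nF _ _ Hb muv).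
have oD : open (~` D).
  by apply: closed_openC; apply: compact_closed; [exact: hausdorff_pt|exact: kD].
have : nbhs m (F @^-1` (~` D)).
  by apply: cF; apply: open_nbhs_nbhs; split=> // /DS[_]; exact.
move=> /nbhs_ballP[d /= d0 bd].
have [w Tw] := sup_adherent d0 hT; rewrite -/m => mw.
have wm : w <= m by exact: sup_upper_bound hT _ Tw.
(* The arc from [w] to [t] has parameters within [d] of [m], hence misses [D], and by injectivity it
   meets the arc from [u] to [w] in [F w] only. So [t] is in [T], and [t <= m] then forces
   [t = v]. *)
pose t := Num.min (m + d / 2) v.
have mt : m <= t by rewrite le_min mv andbT lerDl divr_ge0// ltW.
have td : t <= m + d / 2 by rewrite ge_min lexx.
have tv : t <= v by rewrite ge_min lexx orbT.
have [/andP[uw wv] cw] := Tw.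
have Tt : T t.
  split; first by rewrite (le_trans um).
  have -> : F @` `[u, t] = F @` `[u, w] `|` F @` `[w, t].
    rewrite -image_setU; congr (_ @` _); apply/seteqP; split=> s /=; rewrite !in_itv /=.
      by move=> /andP[us st]; have [sw|sw] := leP s w; [left; rewrite us|right; rewrite ltW].
    by move=> [/andP[us sw]|/andP[ws st]]; apply/andP; split; lra.
  have Fw1 : (F @` `[u, w]) (F w) by exists w => //; rewrite /= in_itv /= uw lexx.
  have Fw2 : (F @` `[w, t]) (F w) by exists w => //; rewrite /= in_itv /= lexx (le_trans wm).
  have cwt : connected_component (S2 `\` F @` `[w, t]) a b.
    apply/connected_componentP; exists D; split=> // q Dq; split; first by case: (DS _ Dq).
    move=> [s]; rewrite /= in_itv /= => /andP[ws st] sq; apply: (bd s) => /=; last by rewrite sq.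
    by rewrite /ball /= ltr_distlC; apply/andP; split; lra.
  apply: (@janiszewski_sphere R _ _ (connected_component (S2 `\` F @` `[u, w]) a)
     (connected_component (S2 `\` F @` `[w, t]) a) (F w)) => //.
  - exact: closed_arc.
  - exact: closed_arc.
  - by left.
  - move=> q [[s1 /= + <-] [s2 /= + E]]; rewrite !in_itv /= => /andP[a1 a2] /andP[b1 b2].
    have E' : s2 = s1 by apply: Finj => //; apply/andP; split; lra.
    by rewrite /= (_ : s1 = w)//; lra.
  - exact: component_connected.
  - exact: component_connected.
  - exact: connected_component_sub.
  - exact: connected_component_sub.
  - by move/connected_component_sub => [].
  - by move/connected_component_sub => [].
  - case: cw => C [Ca CS cC Cb]; exact: connected_component_refl (CS _ Ca).
  - case: cwt => C [Ca CS cC Cb]; exact: connected_component_refl (CS _ Ca).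
have tm : t <= m by exact: sup_upper_bound hT _ Tt.
have tv' : t = v.
  apply/eqP; rewrite eq_le tv /= leNgt; apply/negP => tv'.
  have : t = m + d / 2 by apply/eqP; move: tv'; rewrite /t; case: (leP (m + d / 2) v) => //; rewrite ltxx.
  lra.
by case: Tt; rewrite tv'.
Qed.

Lemma loop_closed F (J : set (pt R)) : loop_param F J -> closed J.
Proof.
move=> lF; have [cF _ _ EJ] := lF.
have -> : J = F @` `[0, 1]; last exact: closed_arc.
rewrite EJ; apply/seteqP; split=> [_ [t _ <-]|_ [t _ <-]]; last by exists t.
have [t' [/andP[t0' t1'] E]] := loop_shift 0 t lF; exists t' => //.
by rewrite /= in_itv /= t0' ltW// -[1]add0r.
Qed.

(* Otherwise a short arc of [J] around some point has a neighbourhood missing the component of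
   [a], and a connected set joining [a] to [b] off the complementary arc cannot leave it. *)
Lemma curve_boundary F (J : set (pt R)) a b : loop_param F J -> J `<=` S2 ->
  (S2 `\` J) a -> (S2 `\` J) b -> ~ connected_component (S2 `\` J) a b ->
  J `<=` closure (connected_component (S2 `\` J) a).
Proof.
move=> lF; have [cF Fper Finj EJ] := lF; move=> JS Ja Jb nab p; rewrite {1}EJ => -[t0 _ <-].
apply: contrapT => ncl.
have SF t : S2 (F t) by apply: JS; rewrite EJ; exists t.
have [B nB BA] : exists2 B, nbhs (F t0) B & B `&` connected_component (S2 `\` J) a = set0.
  apply: contrapT => H; apply: ncl => B nB; apply/set0P/eqP => E.
  by apply: H; exists B => //; rewrite setIC.
have oB : open (interior B) by exact: open_interior.
have : nbhs t0 (F @^-1` interior B) by apply: cF; exact: nbhs_interior.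
move=> /nbhs_ballP[d /= d0 bd].
(* [c < d] keeps the arc around [F t0] inside [B]; [c <= 1 / 4] leaves a nondegenerate complementary
   arc, of parameter length [1 - 2 * c < 1], on which [F] is injective. *)
pose c := Num.min (d / 2) (1 / 4).
have c0 : 0 < c by rewrite lt_min !divr_gt0.
have cd : c < d by apply: le_lt_trans (_ : d / 2 < d); [rewrite ge_min lexx|rewrite ltr_pdivrMr// ltr_pMr// ltr1n].
have c4 : c <= 1 / 4 by rewrite ge_min lexx orbT.
have oS : sphere_open (S2 `\` J) by apply: sphere_openD; exact: loop_closed lF.
have sub : S2 `\` J `<=` S2 `\` F @` `[t0 + c, t0 + 1 - c].
  by move=> q [Sq nq]; split=> // -[s _ sq]; apply: nq; rewrite EJ; exists s.
have /connected_componentP[C [cC CS Ca Cb]] :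
    connected_component (S2 `\` F @` `[t0 + c, t0 + 1 - c]) a b.
  apply: arc_does_not_separate => //; [lra| |exact: sub|exact: sub].
  move=> s t /andP[s1 s2] /andP[t1 t2]; apply: Finj; rewrite ltr_distlC; apply/andP; split; lra.
have oA := component_sphere_open a oS; have oN := cocomponent_sphere_open a oS.
set A := connected_component _ a in oA oN BA nab.
have : C `<=` A.
  apply: (sphere_connected_split (H := ((S2 `\` J) `\` A) `|` (interior B `&` S2)) cC) => //.
  - by move=> q /CS[].
  - by apply: sphere_openU => //; exists (interior B).
  - move=> q Cq; have [Sq nq] := CS _ Cq.
    have [Aq|nA] := pselect (A q); [by left|right].
    have [Jq|nJ] := pselect (J q); [right; split=> //|by left].
    move: Jq; rewrite EJ => -[s _ sq].
    have [r [/andP[r1 r2] Er]] := loop_shift (t0 + c) s lF; rewrite sq in Er.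
    have [r3|r3] := leP r (t0 + 1 - c).
      by exfalso; apply: nq; exists r => //; rewrite /= in_itv /= r1.
    have <- : F (r - 1) = q by rewrite -Fper subrK.
    by apply: bd; rewrite /= /ball /= ltr_distlC; apply/andP; split; lra.
  - apply/seteqP; split=> // q [Aq [[_ nA]//|[/interior_subset Bq _]]].
    by rewrite -BA.
  - by exists a; split=> //; exact: connected_component_refl.
by move/(_ b Cb).
Qed.

End Arcs.

(** * Nonplanarity of [K_{3,3}] *)

Section K33.
Context {R : realType}.
Implicit Types (w : R * R) (c d : R -> R * R) (a b : R).

(* [a] is the total variation of the angle of [c u - w] for [u] from [0] to [1]. *)
Definition winding c w a := exists th : R -> R,
  [/\ continuous th, forall u, 0 <= u <= 1 -> polar (c u - w) (th u) & a = th 1 - th 0].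

Lemma winding_uniq c w a b : winding c w a -> winding c w b -> a = b.
Proof.
move=> [th [cth pth ->]] [th' [cth' pth' ->]].
have : th 0 - th' 0 = th 1 - th' 1; last by lra.
apply: (constant_mod_2pi (h := fun u => th u - th' u) (@segment_connected R 0 1));
  rewrite /= ?in_itv /= ?lexx ?ler01//.
  apply: within_for => u _; have c1 := cth u; have c2 := cth' u; by cont.
by move=> u /[1!in_itv] u01; exact: polar_uniq (pth _ u01) (pth' _ u01).
Qed.

Lemma winding_mod c w a p q : winding c w a -> polar (c 1 - w) p -> polar (c 0 - w) q ->
  exists n : int, a = p - q + 2 * pi * n%:~R.
Proof.
move=> [th [_ pth ->]] pp pq.
have i0 : 0 <= (0 : R) <= 1 by rewrite lexx ler01.
have i1 : 0 <= (1 : R) <= 1 by rewrite lexx ler01.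
have [n en] := polar_uniq (pth 1 i1) pp.
have [m em] := polar_uniq (pth 0 i0) pq.
by exists (n - m); rewrite intrB mulrBr -en -em; ring.
Qed.

(* All four windings are increments of one continuous angle of [c u - d v] on the unit square. *)
Lemma winding_square c d : continuous c -> continuous d ->
  (forall u v, 0 <= u <= 1 -> 0 <= v <= 1 -> c u <> d v) ->
  exists a1 a0 b1 b0, [/\ winding c (d 1) a1, winding c (d 0) a0,
    winding d (c 1) b1, winding d (c 0) b0 & a1 - a0 = b1 - b0].
Proof.
move=> cc cd cd0.
pose v (x : R * R) : R * R := c (clamp x.1) - d (clamp x.2).
have i0 : 0 <= (0 : R) <= 1 by rewrite lexx ler01.
have i1 : 0 <= (1 : R) <= 1 by rewrite lexx ler01.
have k0 : clamp (0 : R) = 0 by rewrite clamp_id.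
have k1 : clamp (1 : R) = 1 by rewrite clamp_id.
have cl1 x : {for x, continuous (fun x : R * R => clamp x.1)}.
  by apply: continuous_after; [exact: clamp_continuous|exact: cvg_fst].
have cl2 x : {for x, continuous (fun x : R * R => clamp x.2)}.
  by apply: continuous_after; [exact: clamp_continuous|exact: cvg_snd].
have cv : continuous v.
  move=> x; apply: continuousB.
    exact: (continuous_after (cc _) (cl1 x)).
  exact: (continuous_after (cd _) (cl2 x)).
have v0 x : v x <> (0, 0).
  by move/eqP; rewrite subr_eq0 => /eqP; apply: cd0; exact: clamp_itv.
have [th cth pth] := plane_lift cv v0.
have slice1 y : continuous (fun u => th (u, y)).
  move=> u; have cu : {for u, continuous (fun u : R => (u, y))} by cont.
  exact: (continuous_after (cth _) cu).
have slice2 y : continuous (fun u => th (y, u) + pi).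
  move=> u; have cu : {for u, continuous (fun u : R => (y, u))} by cont.
  have ct : {for u, continuous (fun u : R => th (y, u))} by exact: (continuous_after (cth _) cu).
  by have : {for u, continuous (fun u : R => th (y, u) + pi)} by cont.
exists (th (1, 1) - th (0, 1)), (th (1, 0) - th (0, 0)),
  (th (1, 1) - th (1, 0)), (th (0, 1) - th (0, 0)); split; last by ring.
- exists (fun u => th (u, 1)); split=> // u u01.
  by have := pth (u, 1); rewrite /v /= k1 clamp_id.
- exists (fun u => th (u, 0)); split=> // u u01.
  by have := pth (u, 0); rewrite /v /= k0 clamp_id.
- exists (fun u => th (1, u) + pi); split=> // [u u01|]; last by ring.
  by have := polarN (pth (1, u)); rewrite /v /= k1 clamp_id// opprB.
- exists (fun u => th (0, u) + pi); split=> // [u u01|]; last by ring.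
  by have := polarN (pth (0, u)); rewrite /v /= k0 clamp_id// opprB.
Qed.

(** An arbitrary choice of angle, with no continuity. It serves to write a winding as a difference
    of chosen angles plus whole turns. *)
Definition arg w := get [set t | polar w t].

Lemma argP w : w <> (0, 0) -> polar w (arg w).
Proof. by move=> /polar_exists[t pt]; exact: (@getI _ [set t | polar w t] t). Qed.

(** The odd factor is the source of the parity obstruction. The hypothesis on [w] stands under the
    quantifier so that [choice] yields a total function. *)
Lemma argN w : exists n : int, w <> (0, 0) -> arg w - arg (- w) = pi * (2 * n + 1)%:~R.
Proof.
have [->|w0] := pselect (w = (0, 0)); first by exists 0.
have nw0 : - w <> (0, 0).
  by move=> E; apply: w0; rewrite -[w]opprK E; congr pair; rewrite oppr0.
have pN := polarN (argP nw0); rewrite opprK in pN.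
have [n en] := polar_uniq (argP w0) pN; exists n => _.
rewrite intrD intrM; lra.
Qed.

(** For edges [i j] and [k l] without a common vertex, [winding_square] relates four windings.
    Written as chosen angles plus whole turns, they give the integer identity [E], whose constant 1
    comes from [argN]. In the sum of [E] over the six ordered pairs [(j, l)], with [i] and [k]
    fixed, every term with just one of the indices [j], [l] occurs twice, [mT i k] and the constant
    occur six times, and each of the three sums [mS j l + mS l j] is [-1]. Hence [N k - N i] is
    odd. *)
Lemma K33 (t s : nat -> R * R) (g : nat -> nat -> R -> R * R) :
  (forall i j, (i < 3)%N -> (j < 3)%N ->
     [/\ continuous (g i j), g i j 0 = t i & g i j 1 = s j]) ->
  (forall i j k l, (i < 3)%N -> (j < 3)%N -> (k < 3)%N -> (l < 3)%N ->
     i <> k -> j <> l -> forall u v, 0 <= u <= 1 -> 0 <= v <= 1 -> g i j u <> g k l v) ->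
  False.
Proof.
move=> gP gD.
have i0 : 0 <= (0 : R) <= 1 by rewrite lexx ler01.
have i1 : 0 <= (1 : R) <= 1 by rewrite lexx ler01.
have subN (x y : R * R) : x <> y -> x - y <> (0, 0).
  by move=> xy /eqP; rewrite subr_eq0 => /eqP.
have st i l : (i < 3)%N -> (l < 3)%N -> s l <> t i.
  move=> i3 l3.
  (* The boolean [l == 0], coerced to a number, is an index different from [l]. *)
  have [j j3 jl] : exists2 j, (j < 3)%N & j <> l by exists (l == 0%N) => //; case: l l3 => // -[|[]].
  have [k k3 ki] : exists2 k, (k < 3)%N & k <> i by exists (i == 0%N) => //; case: i i3 => // -[|[]].
  have := gD i j k l i3 j3 k3 l3 (nesym ki) jl 0 1 i0 i1.
  by have [_ -> _] := gP i j i3 j3; have [_ _ ->] := gP k l k3 l3 => /nesym.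
have ss j l : (j < 3)%N -> (l < 3)%N -> j <> l -> s j <> s l.
  move=> j3 l3 jl; have := gD 0%N j 1%N l isT j3 isT l3 (fun e => ltac:(by []))  jl 1 1 i1 i1.
  by have [_ _ ->] := gP 0%N j isT j3; have [_ _ ->] := gP 1%N l isT l3.
have tt i k : (i < 3)%N -> (k < 3)%N -> i <> k -> t i <> t k.
  move=> i3 k3 ik; have := gD i 0%N k 1%N i3 isT k3 isT ik (fun e => ltac:(by [])) 0 0 i0 i0.
  by have [_ -> _] := gP i 0%N i3 isT; have [_ -> _] := gP k 1%N k3 isT.
have [m mP] := choice argN.
have [n nP] : exists n : (R -> R * R) -> R * R -> int, forall c w a, winding c w a ->
    c 1 <> w -> c 0 <> w -> a = arg (c 1 - w) - arg (c 0 - w) + 2 * pi * (n c w)%:~R.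
  have : forall cw : (R -> R * R) * (R * R), exists n : int, forall a, winding cw.1 cw.2 a ->
    cw.1 1 <> cw.2 -> cw.1 0 <> cw.2 ->
    a = arg (cw.1 1 - cw.2) - arg (cw.1 0 - cw.2) + 2 * pi * n%:~R.
    move=> [c w] /=; have [[a wa]|na] := pselect (exists a, winding c w a); last first.
      by exists 0 => a wa; case: na; exists a.
    have [[c1 c0]|nc] := pselect (c 1 <> w /\ c 0 <> w); last by exists 0 => a' _ c1 c0; case: nc.
    have [n en] := winding_mod wa (argP (subN _ _ c1)) (argP (subN _ _ c0)).
    by exists n => a' wa' _ _; rewrite (winding_uniq wa' wa).
  by move=> /choice[n nP]; exists (fun c w => n (c, w)) => c w a; exact: (nP (c, w)).
pose nS i j l := n (g i j) (s l).
pose nT i j k := n (g i j) (t k).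
pose mS j l := m (s j - s l).
pose mT i k := m (t i - t k).
pose mX l i := m (s l - t i).
have E i j k l : (i < 3)%N -> (j < 3)%N -> (k < 3)%N -> (l < 3)%N -> i <> k -> j <> l ->
    mS j l + mT i k + mX l i - mX j k + 1 = nS k l j - nT k l i - nS i j l + nT i j k.
  move=> i3 j3 k3 l3 ik jl.
  have [cg g0 g1] := gP i j i3 j3; have [ch h0 h1] := gP k l k3 l3.
  have [a1 [a0 [b1 [b0 []]]]] := winding_square cg ch (gD _ _ _ _ i3 j3 k3 l3 ik jl).
  rewrite g0 g1 h0 h1 => w1 w2 w3 w4.
  have := nP _ _ _ w1; have := nP _ _ _ w2; have := nP _ _ _ w3; have := nP _ _ _ w4.
  rewrite g0 g1 h0 h1 -/(nS k l j) -/(nT k l i) -/(nS i j l) -/(nT i j k).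
  move=> /(_ (st _ _ i3 l3) (tt _ _ k3 i3 (nesym ik))) -> /(_ (ss _ _ l3 j3 (nesym jl)) (nesym (st _ _ k3 j3))) ->.
  move=> /(_ (st _ _ k3 j3) (tt _ _ i3 k3 ik)) -> /(_ (ss _ _ j3 l3 jl) (nesym (st _ _ i3 l3))) ->.
  have := mP _ (subN _ _ (ss _ _ j3 l3 jl)); have := mP _ (subN _ _ (tt _ _ i3 k3 ik)).
  have := mP _ (subN _ _ (st _ _ i3 l3)); have := mP _ (subN _ _ (st _ _ k3 j3)).
  rewrite !opprB -/(mS j l) -/(mT i k) -/(mX l i) -/(mX j k) => e1 e2 e3 e4 e5.
  apply: (@intr_inj R); apply: (mulfI (lt0r_neq0 (@pi_gt0 R))).
  move: e1 e2 e3 e4 e5; rewrite !(intrD, intrB, intrM); lra.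
have mSC j l : (j < 3)%N -> (l < 3)%N -> j <> l -> mS j l + mS l j + 1 = 0.
  move=> j3 l3 jl; have := mP _ (subN _ _ (ss _ _ j3 l3 jl)).
  have := mP _ (subN _ _ (ss _ _ l3 j3 (nesym jl))).
  rewrite !opprB -/(mS j l) -/(mS l j) => e1 e2.
  apply: (@intr_inj R); apply: (mulfI (lt0r_neq0 (@pi_gt0 R))).
  move: e1 e2; rewrite !(intrD, intrM); lra.
(* By [E] any two of the three integers [N 0], [N 1], [N 2] have different parities. *)
pose N i := nS i 0%N 1%N + nS i 1%N 0%N + nS i 0%N 2%N + nS i 2%N 0%N + nS i 1%N 2%N + nS i 2%N 1%N.
have n01 : 0%N <> 1%N by [].
have n02 : 0%N <> 2%N by [].
have n12 : 1%N <> 2%N by [].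
have par i k : (i < 3)%N -> (k < 3)%N -> i <> k -> exists z, N k = N i + 2 * z + 1.
  move=> i3 k3 ik.
  exists (1 + 3 * mT i k + (mX 0%N i + mX 1%N i + mX 2%N i) - (mX 0%N k + mX 1%N k + mX 2%N k)
    + (nT k 0%N i + nT k 1%N i + nT k 2%N i) - (nT i 0%N k + nT i 1%N k + nT i 2%N k)).
  have := E i 0%N k 1%N i3 isT k3 isT ik n01; have := E i 1%N k 0%N i3 isT k3 isT ik (nesym n01).
  have := E i 0%N k 2%N i3 isT k3 isT ik n02; have := E i 2%N k 0%N i3 isT k3 isT ik (nesym n02).
  have := E i 1%N k 2%N i3 isT k3 isT ik n12; have := E i 2%N k 1%N i3 isT k3 isT ik (nesym n12).
  have := mSC 0%N 1%N isT isT n01; have := mSC 0%N 2%N isT isT n02; have := mSC 1%N 2%N isT isT n12.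
  rewrite /N; clearbody nS nT mS mT mX; clear; lra.
have [z1 e1] := par 0%N 1%N isT isT n01; have [z2 e2] := par 0%N 2%N isT isT n02.
have [z3 e3] := par 1%N 2%N isT isT n12.
by clearbody N; move: e1 e2 e3; clear; lia.
Qed.

Definition path_in (A : set (R * R)) (x y : R * R) := exists c : R -> R * R,
  [/\ continuous c, c 0 = x, c 1 = y & forall u, 0 <= u <= 1 -> A (c u)].

(* Only edges without a common vertex are required to be disjoint. *)
Lemma K33_sets (t s : nat -> R * R) (S : nat -> nat -> set (R * R)) :
  (forall i j, (i < 3)%N -> (j < 3)%N -> path_in (S i j) (t i) (s j)) ->
  (forall i j k l, (i < k)%N -> (j < 3)%N -> (k < 3)%N -> (l < 3)%N -> j <> l ->
     S i j `&` S k l = set0) -> False.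
Proof.
move=> SP S0.
have [g gP] : exists g : nat -> nat -> R -> R * R, forall i j, (i < 3)%N -> (j < 3)%N ->
   [/\ continuous (g i j), g i j 0 = t i, g i j 1 = s j &
       forall u, 0 <= u <= 1 -> S i j (g i j u)].
  have : forall ij : nat * nat, exists c : R -> R * R, (ij.1 < 3)%N -> (ij.2 < 3)%N ->
      [/\ continuous c, c 0 = t ij.1, c 1 = s ij.2 & forall u, 0 <= u <= 1 -> S ij.1 ij.2 (c u)].
    move=> [i j] /=; case: (boolP ((i < 3)%N && (j < 3)%N)) => [/andP[i3 j3]|nij]; last first.
      by exists (fun=> (0, 0)) => i3 j3; rewrite i3 j3 in nij.
    by have [c cP] := SP i j i3 j3; exists c.
  by move=> /choice[g gP]; exists (fun i j => g (i, j)) => i j; exact: (gP (i, j)).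
apply: (@K33 t s g) => [i j i3 j3|i j k l i3 j3 k3 l3 ik jl u w u01 w01 E].
  by have [] := gP i j i3 j3.
have [_ _ _ Sg] := gP i j i3 j3; have [_ _ _ Sg'] := gP k l k3 l3.
have H1 := Sg u u01; have H2 := Sg' w w01; rewrite E in H1.
have [ik'|ki|//] := ltngtP i k.
  by have : (S i j `&` S k l) (g k l w) by []; rewrite S0.
by have : (S k l `&` S i j) (g k l w) by []; rewrite S0//; exact: nesym.
Qed.

End K33.

(** * Paths in open sets and near continua; open sets joined by continua *)

Section Paths.
Context {R : realType}.
Implicit Types (x y z : R * R) (A C K : set (R * R)).

Lemma path_in_sub A C x y : A `<=` C -> path_in A x y -> path_in C x y.
Proof. by move=> AC [c [cc c0 c1 cA]]; exists c; split=> // u /cA /AC. Qed.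

Lemma path_in_sym A x y : path_in A x y -> path_in A y x.
Proof.
move=> [c [cc c0 c1 cA]]; exists (fun u => c (1 - u)); split.
- move=> u; have cu : {for u, continuous (fun u : R => 1 - u)} by cont.
  exact: (continuous_after (cc _) cu).
- by rewrite subr0.
- by rewrite subrr.
- by move=> u /andP[u0 u1]; apply: cA; apply/andP; split; lra.
Qed.

Lemma path_in_trans A x y z : path_in A x y -> path_in A y z -> path_in A x z.
Proof.
move=> [c [cc c0 c1 cA]] [d [cd d0 d1 dA]].
have k0 (t : R) : t <= 0 -> clamp t = 0.
  by move=> t0; rewrite /clamp ler0_norm// ler0_norm; lra.
have k1 (t : R) : 1 <= t -> clamp t = 1.
  by move=> t1; rewrite /clamp ger0_norm ?ger0_norm; lra.
(* At every [u] at least one of the two clamped terms equals [y], so subtracting [y] leaves the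
   other: a concatenation without case distinction. *)
exists (fun u => c (clamp (2 * u)) + d (clamp (2 * u - 1)) - y); split.
- have cl (f : R -> R) u : {for u, continuous f} -> {for u, continuous (fun u => clamp (f u))}.
    by move=> cf; apply: (continuous_after _ cf); exact: clamp_continuous.
  move=> u; have e1 : {for u, continuous (fun u : R => 2 * u)} by cont.
  have e2 : {for u, continuous (fun u : R => 2 * u - 1)} by cont.
  have ca : {for u, continuous (fun u : R => c (clamp (2 * u)))} := continuous_after (cc _) (cl _ _ e1).
  have cb : {for u, continuous (fun u : R => d (clamp (2 * u - 1)))} := continuous_after (cd _) (cl _ _ e2).
  suff : {for u, continuous (fun u : R => c (clamp (2 * u)) + d (clamp (2 * u - 1)) - y)} by [].
  by apply: continuousB; [exact: continuousD|exact: cvg_cst].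
- by rewrite mulr0 k0// k0 ?sub0r ?lerN10// c0 d0 addrK.
- have e1 : clamp (2 * 1 : R) = 1 by apply: k1; lra.
  have e2 : clamp (2 * 1 - 1 : R) = 1 by apply: k1; lra.
  by rewrite e1 e2 c1 d1 addrAC subrr add0r.
- move=> u /andP[u0 u1]; have [uh|uh] := leP (2 * u) 1.
    have e : clamp (2 * u - 1) = 0 by apply: k0; lra.
    by rewrite e d0 addrK; apply: cA; exact: clamp_itv.
  have e : clamp (2 * u) = 1 by apply: k1; lra.
  by rewrite e c1 addrAC subrr add0r; apply: dA; exact: clamp_itv.
Qed.

Lemma path_in_segment x y : path_in
  [set z | exists2 t, 0 <= t <= 1 & z = (x.1 + t * (y.1 - x.1), x.2 + t * (y.2 - x.2))] x y.
Proof.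
exists (fun t => (x.1 + t * (y.1 - x.1), x.2 + t * (y.2 - x.2))); split.
- move=> t.
  by have : {for t, continuous (fun t : R => (x.1 + t * (y.1 - x.1), x.2 + t * (y.2 - x.2)))} by cont.
- by rewrite !mul0r !addr0 -surjective_pairing.
- by rewrite !mul1r !subrKC -surjective_pairing.
- by move=> u u01; exists u.
Qed.

Lemma path_in_ball x r y : ball x r y -> path_in (ball x r) x y.
Proof.
move=> [b1 b2]; apply: path_in_sub (path_in_segment x y) => _ [t /andP[t0 t1] ->].
split; rewrite /ball /= opprD addrA subrr sub0r normrN.
  apply: le_lt_trans (_ : `|y.1 - x.1| < r); last by rewrite distrC.
  by rewrite normrM ger0_norm// ler_piMl.
apply: le_lt_trans (_ : `|y.2 - x.2| < r); last by rewrite distrC.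
by rewrite normrM ger0_norm// ler_piMl.
Qed.

Lemma open_path A x y : open A -> connected A -> A x -> A y -> path_in A x y.
Proof.
move=> oA cA Ax Ay.
have loc z : A z -> \forall w \near z, path_in A z w.
  move=> Az; have /nbhs_ballP[r /= r0 rA] : nbhs z A by apply: open_nbhs_nbhs.
  apply/nbhs_ballP; exists r => // w bw.
  by apply: path_in_sub rA _; exact: path_in_ball.
have end_in z : path_in A x z -> A z.
  by move=> [c [_ _ <- cA']]; apply: cA'; rewrite lexx ler01.
have : A `<=` [set z | path_in A x z].
  apply: (@connected_split _ _ _ (A `\` [set z | path_in A x z]) cA).
  - rewrite openE => z /= xz; apply: filterS (loc z (end_in _ xz)) => w.
    exact: path_in_trans.
  - rewrite openE => z [Az nz]; have nA : nbhs z A by apply: open_nbhs_nbhs.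
    apply: filterS2 nA (loc z Az) => w Aw zw; split=> // xw; apply: nz.
    exact: path_in_trans xw (path_in_sym zw).
  - by move=> z Az; have [|] := pselect (path_in A x z); [left|right].
  - by apply/seteqP; split=> // z [[_ xz] [_]].
  - exists x; split=> //; exists (fun=> x); split=> // u; exact: cvg_cst.
by apply.
Qed.

Definition thicken C (r : R) : set (R * R) := \bigcup_(x in C) ball x r.

(** A continuum need not contain a path between its points, but its open neighbourhood does, being
    connected: it is a union of sets [ball z r] with [C] adjoined, all sharing [C]. *)
Lemma thicken_path C r x y : 0 < r -> connected C -> C x -> C y -> path_in (thicken C r) x y.
Proof.
move=> r0 cC Cx Cy.
have CN : C `<=` thicken C r by move=> z Cz; exists z => //; exact: ballxx.
apply: open_path; [|..|exact: CN|exact: CN].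
  by apply: bigcup_open => z _; exact: ball_open.
have -> : thicken C r = \bigcup_(z in C) (ball z r `|` C).
  apply/seteqP; split=> [w [z Cz bw]|w [z Cz [bw|/CN//]]]; first by exists z => //; left.
  by exists z.
apply: bigcup_connected; first by exists x => z Cz; right.
move=> z Cz; apply: connectedU => //; first by exists z; split=> //; exact: ballxx.
exact: ball_connected.
Qed.

Lemma compact_sep {T : pseudoMetricType R} (X Y : set T) : compact X -> closed Y ->
  X `&` Y = set0 -> exists2 e : R, 0 < e & forall p q, X p -> Y q -> ~ ball p e q.
Proof.
move=> /compact_near_coveringP cX cY XY.
have := cX R (0^'+) (fun d p => forall q, Y q -> ~ ball p d q) _.
case=> [p Xp|d /= d0 H].
  have nYp : ~ Y p by move=> Yp; rewrite -[False]/(set0 p) -XY.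
  have /nbhs_ballP[e /= e0 eY] : nbhs p (~` Y).
    by apply: open_nbhs_nbhs; split=> //; exact: closed_openC.
  have e20 : 0 < e / 2 by rewrite divr_gt0.
  exists (ball p (e / 2), [set d | d < e / 2]) => /=.
    by split; [exact: nbhsx_ballx | exact: nbhs_right_lt].
  move=> [p' d] /= [bp' de] q Yq bpq; apply: (eY q) => //.
  by rewrite [e]splitr; apply: (ball_triangle bp'); apply: le_ball bpq; exact: ltW.
exists (d / 2); first by rewrite divr_gt0.
move=> p q Xp Yq; apply: (H (d / 2)) => //=; last by rewrite divr_gt0.
by rewrite sub0r normrN gtr0_norm ?divr_gt0// ltr_pdivrMr// mulr_natr mulr2n ltrDl.
Qed.

Lemma finite_radius n (Q : nat -> R -> Prop) :
  (forall i e e', e' <= e -> Q i e -> Q i e') ->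
  (forall i, (i < n)%N -> exists2 e, 0 < e & Q i e) ->
  exists2 e, 0 < e & forall i, (i < n)%N -> Q i e.
Proof.
move=> mono; elim: n => [_|n IH H]; first by exists 1.
have [e e0 He] : exists2 e, 0 < e & forall i, (i < n)%N -> Q i e.
  by apply: IH => i ilt; apply: H; rewrite ltnS ltnW.
have [e' e'0 He'] := H n (ltnSn n).
exists (Num.min e e'); first by rewrite lt_min e0.
move=> i; rewrite ltnS leq_eqVlt => /orP[/eqP ->|ilt].
  by apply: (mono _ e') => //; rewrite ge_min lexx orbT.
by apply: (mono _ e); [rewrite ge_min lexx|exact: He].
Qed.

(* A drawing of [K_{3,3}]: the edge from [i] to [j] runs inside [A i] until it is close to
   [p i j], and then stays in a small neighbourhood of [P j]. *)
Lemma three_open_three_continua (A P : nat -> set (R * R)) (p : nat -> nat -> R * R) :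
  (forall i, (i < 3)%N -> open (A i) /\ connected (A i)) ->
  (forall i k, (i < 3)%N -> (k < 3)%N -> i <> k -> A i `&` A k = set0) ->
  (forall j, (j < 3)%N -> compact (P j) /\ connected (P j)) ->
  (forall j l, (j < 3)%N -> (l < 3)%N -> j <> l -> P j `&` P l = set0) ->
  (forall i j, (i < 3)%N -> (j < 3)%N -> A i `&` P j = set0) ->
  (forall i j, (i < 3)%N -> (j < 3)%N -> P j (p i j) /\ closure (A i) (p i j)) ->
  (forall i j k, (i < 3)%N -> (j < 3)%N -> (k < 3)%N -> i <> k -> ~ closure (A k) (p i j)) ->
  False.
Proof.
move=> oA A0 cP P0 AP pP pA.
have disj (X Y : set (R * R)) x : X `&` Y = set0 -> X x -> Y x -> False.
  by move=> XY Xx Yx; rewrite -[False]/(set0 x) -XY.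
have clP j : (j < 3)%N -> closed (P j).
  by move=> j3; apply: compact_closed; [exact: norm_hausdorff|exact: (cP j j3).1].
(* [e1] keeps the ball around [p i j] away from every [A k] with [k <> i]. [e2] separates the
   continua from one another and is halved in [e], so that [e]-balls centred on different continua
   are disjoint. *)
have [e1 e10 He1] : exists2 e, 0 < e & forall i, (i < 3)%N -> forall j, (j < 3)%N ->
    forall k, (k < 3)%N -> i <> k -> forall x, ball (p i j) e x -> A k x -> False.
  apply: finite_radius => [i e e' ee H j j3 k k3 ik x bx|i i3].
    by apply: (H j j3 k k3 ik); exact: le_ball bx.
  apply: finite_radius => [j e e' ee H k k3 ik x bx|j j3].
    by apply: (H k k3 ik); exact: le_ball bx.
  apply: finite_radius => [k e e' ee H ik x bx|k k3].
    by apply: (H ik); exact: le_ball bx.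
  have [->|ik] := eqVneq i k; first by exists 1.
  have : nbhs (p i j) (~` closure (A k)).
    apply: open_nbhs_nbhs; split; first exact/closed_openC/closed_closure.
    by apply: pA => //; exact/eqP.
  move=> /nbhs_ballP[e /= e0 eA]; exists e => // _ x /eA nA Ax.
  by apply: nA; exact: subset_closure.
have [e2 e20 He2] : exists2 e, 0 < e & forall j, (j < 3)%N -> forall l, (l < 3)%N -> j <> l ->
    forall x y, P j x -> P l y -> ~ ball x e y.
  apply: finite_radius => [j e e' ee H l l3 jl x y Px Py bx|j j3].
    by apply: (H l l3 jl x y Px Py); exact: le_ball bx.
  apply: finite_radius => [l e e' ee H jl x y Px Py bx|l l3].
    by apply: (H jl x y Px Py); exact: le_ball bx.
  have [->|/eqP jl] := eqVneq j l; first by exists 1.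
  by have [e e0 He] := compact_sep (cP j j3).1 (clP l l3) (P0 _ _ j3 l3 jl); exists e.
pose e := Num.min e1 (e2 / 2).
have e0 : 0 < e by rewrite lt_min e10 divr_gt0.
have ee1 : e <= e1 by rewrite ge_min lexx.
have ee2 : e + e <= e2 by rewrite -mulr2n -mulr_natr -ler_pdivlMr// ge_min lexx orbT.
have [v vP] : exists v : nat -> nat -> R * R, forall i j, (i < 3)%N -> (j < 3)%N ->
    A i (v i j) /\ ball (p i j) e (v i j).
  have : forall ij : nat * nat, exists x, (ij.1 < 3)%N -> (ij.2 < 3)%N ->
      A ij.1 x /\ ball (p ij.1 ij.2) e x.
    move=> [i j] /=; case: (boolP ((i < 3)%N && (j < 3)%N)) => [/andP[i3 j3]|nij]; last first.
      by exists (0, 0) => i3 j3; rewrite i3 j3 in nij.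
    have [x [Ax bx]] := (pP i j i3 j3).2 _ (nbhsx_ballx (p i j) e e0).
    by exists x.
  by move=> /choice[v vP]; exists (fun i j => v (i, j)) => i j; exact: (vP (i, j)).
have [a aP] : exists a : nat -> nat -> R -> R * R, forall i j, (i < 3)%N -> (j < 3)%N ->
   [/\ continuous (a i j), a i j 0 = v i 0%N, a i j 1 = v i j &
       forall u, 0 <= u <= 1 -> A i (a i j u)].
  have : forall ij : nat * nat, exists c : R -> R * R, (ij.1 < 3)%N -> (ij.2 < 3)%N ->
      [/\ continuous c, c 0 = v ij.1 0%N, c 1 = v ij.1 ij.2 & forall u, 0 <= u <= 1 -> A ij.1 (c u)].
    move=> [i j] /=; case: (boolP ((i < 3)%N && (j < 3)%N)) => [/andP[i3 j3]|nij]; last first.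
      by exists (fun=> (0, 0)) => i3 j3; rewrite i3 j3 in nij.
    have [c cP'] := open_path (oA i i3).1 (oA i i3).2 (vP i 0%N i3 isT).1 (vP i j i3 j3).1.
    by exists c.
  by move=> /choice[a aP]; exists (fun i j => a (i, j)) => i j; exact: (aP (i, j)).
pose I01 : set R := [set u | 0 <= u <= 1].
have cI : compact I01.
  have -> : I01 = [set` `[0, 1]] by apply/seteqP; split=> u; rewrite /= in_itv.
  exact: segment_compact.
(* This radius can be chosen only after the paths [a i j]: the open sets [A i] come arbitrarily
   close to the continua, the compact images of the paths do not. *)
have [h0 h00 Hh] : exists2 h, 0 < h & forall i, (i < 3)%N -> forall j, (j < 3)%N ->
    forall l, (l < 3)%N -> forall x y, P l x -> (a i j @` I01) y -> ~ ball x h y.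
  apply: finite_radius => [i r r' ee H j j3 l l3 x y Px ay bx|i i3].
    by apply: (H j j3 l l3 x y Px ay); exact: le_ball bx.
  apply: finite_radius => [j r r' ee H l l3 x y Px ay bx|j j3].
    by apply: (H l l3 x y Px ay); exact: le_ball bx.
  apply: finite_radius => [l r r' ee H x y Px ay bx|l l3].
    by apply: (H x y Px ay); exact: le_ball bx.
  have [ca _ _ aA] := aP i j i3 j3.
  apply: compact_sep; first exact: (cP l l3).1.
    apply: compact_closed; first exact: norm_hausdorff.
    by apply: continuous_compact => //; apply: within_for => u _; exact: ca.
  apply/seteqP; split=> // z [Px [u u01 /= E]]; rewrite -E in Px.
  exact: disj (AP i l i3 l3) (aA u u01) Px.
pose h := Num.min h0 e.
have hh0 : 0 < h by rewrite lt_min h00.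
have hle0 : h <= h0 by rewrite ge_min lexx.
have hle : h <= e by rewrite ge_min lexx orbT.
(* The vertex standing for [A i] is [v i 0], the one standing for [P j] is [p 0 j]; the thickened
   continuum leads from [p i j] to [p 0 j]. *)
pose S i j := (a i j @` I01) `|` ball (p i j) e `|` thicken (P j) h.
have Spath i j : (i < 3)%N -> (j < 3)%N -> path_in (S i j) (v i 0%N) (p 0%N j).
  move=> i3 j3; apply: (@path_in_trans _ _ (v i j)).
    apply: path_in_sub (_ : path_in (a i j @` I01) _ _); first by move=> x ax; left; left.
    have [ca a0 a1 aA] := aP i j i3 j3; exists (a i j); split=> // u u01; by exists u.
  apply: (@path_in_trans _ _ (p i j)).
    apply: path_in_sub (path_in_sym (path_in_ball (vP i j i3 j3).2)).
    by move=> x bx; left; right.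
  apply: path_in_sub (_ : path_in (thicken (P j) h) _ _); first by move=> x bx; right.
  apply: thicken_path => //; first exact: (cP j j3).2.
    exact: (pP i j i3 j3).1.
  exact: (pP 0%N j isT j3).1.
have S0 i j k l x : (i < 3)%N -> (j < 3)%N -> (k < 3)%N -> (l < 3)%N -> i <> k -> j <> l ->
    S i j x -> S k l x -> False.
  move=> i3 j3 k3 l3 ik jl.
  have aA i' j' y : (i' < 3)%N -> (j' < 3)%N -> (a i' j' @` I01) y -> A i' y.
    by move=> i'3 j'3 [u u01 <-]; have [_ _ _] := aP i' j' i'3 j'3; exact.
  have aN i' j' l' y : (i' < 3)%N -> (j' < 3)%N -> (l' < 3)%N -> (a i' j' @` I01) y ->
      thicken (P l') h y -> False.
    move=> i'3 j'3 l'3 ay [z Pz bz]; apply: (Hh i' i'3 j' j'3 l' l'3 z y Pz ay).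
    exact: le_ball bz.
  have ab i' j' k' l' y : (i' < 3)%N -> (j' < 3)%N -> (k' < 3)%N -> (l' < 3)%N -> i' <> k' ->
      (a i' j' @` I01) y -> ball (p k' l') e y -> False.
    move=> i'3 j'3 k'3 l'3 ik' ay bz; apply: (He1 k' k'3 l' l'3 i' i'3 (nesym ik') y).
      exact: le_ball bz.
    exact: aA ay.
  have PP y z : P j y -> P l z -> ball y e x -> ball z e x -> False.
    move=> Py Pz by' bz; apply: (He2 j j3 l l3 jl y z Py Pz).
    by apply: (le_ball ee2); apply: ball_triangle by' _; exact: ball_sym.
  have bt m : thicken (P m) h x -> exists2 y, P m y & ball y e x.
    by move=> [y Py bx]; exists y => //; exact: le_ball bx.
  have pj := (pP i j i3 j3).1; have pl := (pP k l k3 l3).1.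
  move=> [[ax|bx]|tx] [[ax'|bx']|tx'].
  - exact: disj (A0 i k i3 k3 ik) (aA _ _ _ i3 j3 ax) (aA _ _ _ k3 l3 ax').
  - exact: (ab i j k l x).
  - exact: (aN i j l x).
  - exact: (ab k l i j x k3 l3 i3 j3 (nesym ik)).
  - exact: PP pj pl bx bx'.
  - by have [y Py by'] := bt l tx'; exact: PP pj Py bx by'.
  - exact: (aN k l j x).
  - by have [y Py by'] := bt j tx; exact: PP Py pl by' bx'.
  - by have [y Py by'] := bt j tx; have [z Pz bz] := bt l tx'; exact: PP Py Pz by' bz.
apply: (@K33_sets R (fun i => v i 0%N) (p 0%N) S).
  by move=> i j i3 j3; exact: Spath.
move=> i j k l ik j3 k3 l3 jl; apply/seteqP; split=> // x [Sx Sx'].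
apply: (S0 i j k l x) => //; first exact: ltn_trans k3.
by move=> E; rewrite E ltnn in ik.
Qed.

End Paths.

(** * The Jordan separation theorem *)

Section Jordan.
Context {R : realType}.
Implicit Types (x y z : R * R) (F : R -> R * R) (J : set (R * R)).

Lemma path_in_arc F a b : continuous F -> a <= b -> path_in (F @` `[a, b]) (F a) (F b).
Proof.
move=> cF ab; exists (fun u => F (a + u * (b - a))); split.
- move=> u; have cu : {for u, continuous (fun u : R => a + u * (b - a))} by cont.
  exact: (continuous_after (cF _) cu).
- by rewrite mul0r addr0.
- by rewrite mul1r subrKC.
- move=> u /andP[u0 u1]; exists (a + u * (b - a)) => //; rewrite /= in_itv /=.
  by apply/andP; split; nra.
Qed.

Lemma path_in_line (A : set (R * R)) x y :
  (forall t, 0 <= t <= 1 -> A (x.1 + t * (y.1 - x.1), x.2 + t * (y.2 - x.2))) -> path_in A x y.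
Proof. by move=> H; apply: path_in_sub (path_in_segment x y) => _ [t t01 ->]; exact: H. Qed.

Lemma ivt (f : R -> R) a b v : continuous f -> a <= b ->
  f a <= v <= f b \/ f b <= v <= f a -> exists c, a <= c <= b /\ f c = v.
Proof.
move=> cf ab H.
have cw : {within `[a, b], continuous f} by apply: within_for => t _; exact: cf.
have [|c] := @IVT R f a b v ab cw; last by rewrite in_itv /= => cab fc; exists c.
by rewrite ge_min le_max; case: H => /andP[-> ->]; rewrite ?orbT.
Qed.

(** On a vertical line the second coordinate alone would be injective on the loop. But a value
    strictly between those at 0 and [1 / 2] is taken on both halves of the period. *)
Lemma loop_width F J : loop_param F J -> exists s t, (F s).1 < (F t).1.
Proof.
move=> [cF Fper Finj _]; apply: contrapT => H.
have Xc s t : (F s).1 = (F t).1.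
  apply/eqP; rewrite eq_le !leNgt; apply/andP.
  by split; apply/negP => st; apply: H; [exists t, s|exists s, t].
have eqF s t : (F s).2 = (F t).2 -> F s = F t.
  by move=> E; rewrite [F s]surjective_pairing [F t]surjective_pairing E (Xc s t).
pose g t := (F t).2.
have cg : continuous g.
  by move=> t; have cFt := cF t; have : {for t, continuous (fun t : R => (F t).2)} by cont.
have g01 : g 1 = g 0 by rewrite /g -[1]add0r Fper.
have gh : g 0 <> g (1 / 2).
  move=> /eqF /Finj; rewrite sub0r normrN ger0_norm ?divr_ge0// => H'.
  have : (0 : R) = 1 / 2 by apply: H'; lra.
  lra.
pose c := (g 0 + g (1 / 2)) / 2.
have bd : g 0 <= c <= g (1 / 2) \/ g (1 / 2) <= c <= g 0.
  by have [h|h] := leP (g 0) (g (1 / 2)); [left|right]; rewrite /c; apply/andP; split; lra.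
have [||s [/andP[s0 s1] sc]] := @ivt g 0 (1 / 2) c cg; [lra|exact: bd|].
have [||t [/andP[t0 t1] tc]] := @ivt g (1 / 2) 1 c cg; [lra|by rewrite g01; case: bd; [right|left]|].
have cn0 : c <> g 0 by rewrite /c => E; apply: gh; lra.
have cnh : c <> g (1 / 2) by rewrite /c => E; apply: gh; lra.
have sn0 : s != 0 by apply/eqP => E; apply: cn0; rewrite -sc E.
have snh : s != 1 / 2 by apply/eqP => E; apply: cnh; rewrite -sc E.
have s0' : 0 < s by rewrite lt_neqAle eq_sym sn0.
have s1' : s < 1 / 2 by rewrite lt_neqAle snh.
have : s = t.
  apply: Finj; last by apply: eqF; rewrite -/(g s) -/(g t) sc tc.
  by rewrite ltr_norml; apply/andP; split; lra.
lra.
Qed.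

Lemma arcs_disjoint F J a b a' b' : loop_param F J -> b' - a < 1 -> b - a' < 1 ->
  b < a' -> F @` `[a, b] `&` F @` `[a', b'] = set0.
Proof.
move=> [_ _ Finj _] h1 h2 dis; apply/seteqP; split=> // z [[u + <-] [v + E]].
rewrite /= !in_itv /= => /andP[u1 u2] /andP[v1 v2].
have : v = u by apply: Finj E; rewrite ltr_norml; apply/andP; split; lra.
lra.
Qed.

(* If the complement of [J] were connected, [K_{3,3}] could be drawn in the plane. Three of its
   vertices are a leftmost point [F t1], a rightmost point [F t2] and the middle [x4] of a vertical
   segment with ends [F s] and [F r] on the two arcs between them; the other three are [F s],
   [F r] and a point [x5] above [J], joined to [F t1] and [F t2] around the curve and to [x4] in
   the complement. *)
Lemma loop_separates F J : loop_param F J ->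
  ~ (forall x y, ~ J x -> ~ J y -> path_in (~` J) x y).
Proof.
move=> lF conn; have [cF Fper Finj EJ] := lF.
pose X t := (F t).1; pose Y t := (F t).2.
have cX : continuous X.
  by move=> t; have cFt := cF t; have : {for t, continuous (fun t : R => (F t).1)} by cont.
have cY : continuous Y.
  by move=> t; have cFt := cF t; have : {for t, continuous (fun t : R => (F t).2)} by cont.
have cXw (A : set R) : {within A, continuous X} by apply: within_for => t _; exact: cX.
have cYw (A : set R) : {within A, continuous Y} by apply: within_for => t _; exact: cY.
have all01 (Z : R -> R) (P : R -> Prop) :
    (forall t, t \in `[0, 1] -> P (Z t)) -> (forall s t, F s = F t -> Z s = Z t) -> forall t, P (Z t).
  move=> H Zq t; have [t' [/andP[t0 t1] E]] := loop_shift 0 t lF.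
  by rewrite -(Zq _ _ E); apply: H; rewrite in_itv /= t0 ltW// -[1]add0r.
have Xq s t : F s = F t -> X s = X t by rewrite /X => ->.
have Yq s t : F s = F t -> Y s = Y t by rewrite /Y => ->.
have [t1 _ min1] := EVT_min (@ler01 R) (cXw _).
have [t2_ _ max2] := EVT_max (@ler01 R) (cXw _).
have [ty _ maxy] := EVT_max (@ler01 R) (cYw _).
have Xmin t : X t1 <= X t := all01 X (fun v => X t1 <= v) min1 Xq t.
have Xmax_ t : X t <= X t2_ := all01 X (fun v => v <= X t2_) max2 Xq t.
have Ymax t : Y t <= Y ty := all01 Y (fun v => v <= Y ty) maxy Yq t.
have [t2 [/andP[t12 t21] Et2]] := loop_shift t1 t2_ lF.
have Xmax t : X t <= X t2 by rewrite (Xq _ _ Et2).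
have mM : X t1 < X t2.
  have [s [t st]] := loop_width lF.
  exact: le_lt_trans (Xmin s) (lt_le_trans st (Xmax t)).
have t12' : t1 < t2 by rewrite lt_neqAle t12 andbT; apply/eqP => E; move: mM; rewrite E ltxx.
have F11 : F (t1 + 1) = F t1 by rewrite Fper.
have X11 : X (t1 + 1) = X t1 by rewrite /X F11.
pose c := (X t1 + X t2) / 2.
have c1 : X t1 < c by rewrite /c; lra.
have c2 : c < X t2 by rewrite /c; lra.
(* Both arcs between the extreme points cross the line of abscissa [c]. A closest pair of crossings,
   one on each arc, exists by compactness; a further point of the curve between them would lie on
   one of the arcs and give a closer pair. *)
pose KK : set (R * R) := [set w | [/\ t1 <= w.1 <= t2, X w.1 = c, t2 <= w.2 <= t1 + 1 & X w.2 = c]].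
have KK0 : KK !=set0.
  have [||s [s12 sc]] := @ivt X t1 t2 c cX; [exact: ltW|by left; rewrite !ltW|].
  have [||r [r12 rc]] := @ivt X t2 (t1 + 1) c cX; [exact: ltW|by right; rewrite X11 !ltW|].
  by exists (s, r).
have cXf : continuous (fun w : R * R => X w.1).
  move=> w; have cw : {for w, continuous (fun w : R * R => w.1)} by cont.
  exact: (continuous_after (cX _) cw).
have cXs : continuous (fun w : R * R => X w.2).
  move=> w; have cw : {for w, continuous (fun w : R * R => w.2)} by cont.
  exact: (continuous_after (cX _) cw).
have cKK : compact KK.
  have -> : KK = (`[t1, t2] `*` `[t2, t1 + 1]) `&`
      ((fun w : R * R => X w.1) @^-1` [set c] `&` (fun w : R * R => X w.2) @^-1` [set c]).
    apply/seteqP; split=> [w []|w [[]]]; rewrite /= ?in_itv //=.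
    by move=> w1 w2 [].
  apply: compact_closedI; first by apply: compact_setX; exact: segment_compact.
  by apply: closedI; apply: preimage_closed; try exact: closed_eq; move=> w _; [exact: cXf|exact: cXs].
have [[s r] /= [/andP[s1 s2] Xs /andP[r2 r1] Xr] Hmin] : exists2 w, KK w & forall w', KK w' ->
    `|Y w.1 - Y w.2| <= `|Y w'.1 - Y w'.2|.
  have cN : continuous (fun w : R * R => `|Y w.1 - Y w.2|).
    move=> w; have w1 : {for w, continuous (fun w : R * R => w.1)} by cont.
    have w2 : {for w, continuous (fun w : R * R => w.2)} by cont.
    have y1 : {for w, continuous (fun w : R * R => Y w.1)} := continuous_after (cY _) w1.
    have y2 : {for w, continuous (fun w : R * R => Y w.2)} := continuous_after (cY _) w2.
    have yd : {for w, continuous (fun w : R * R => Y w.1 - Y w.2)} by cont.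
    exact: (continuous_after (@norm_continuous _ _ _) yd).
  have [|w Kw Hw] := compact_EVT_min KK0 cKK (f := fun w : R * R => `|Y w.1 - Y w.2|).
    by apply: within_for => w _; exact: cN.
  exists w; first by rewrite inE in Kw.
  by move=> w' Kw'; apply: Hw; rewrite inE.
have neqX a b : X a <> X b -> a != b by move=> h; apply/eqP => E; apply: h; rewrite E.
have s1' : t1 < s.
  by rewrite lt_neqAle s1 andbT; apply: neqX; rewrite Xs; lra.
have s2' : s < t2.
  by rewrite lt_neqAle s2 andbT; apply: neqX; rewrite Xs; lra.
have r2' : t2 < r.
  by rewrite lt_neqAle r2 andbT; apply: neqX; rewrite Xr; lra.
have r1' : r < t1 + 1.
  by rewrite lt_neqAle r1 andbT; apply: neqX; rewrite Xr X11; lra.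
have inj a b : t1 < a -> a < t1 + 1 -> t1 <= b -> b <= t1 + 1 -> F a = F b -> a = b.
  by move=> a1 a2 b1 b2; apply: Finj; move: a1 a2 b1 b2; clear; rewrite ltr_norml; move=> *; lra.
have t2le : t2 <= t1 + 1 := ltW t21.
have sle : s <= t1 + 1 := le_trans s2 t2le.
have t1r : t1 <= r := le_trans t12 r2.
have st1 : s < t1 + 1 := lt_trans s2' t21.
have rt1 : t1 < r := lt_trans t12' r2'.
have sr : s < r := lt_trans s2' r2'.
have Ysr : Y s <> Y r.
  move=> E; have : F s = F r.
    by rewrite [F s]surjective_pairing [F r]surjective_pairing -/(X s) -/(X r) -/(Y s) -/(Y r) E Xs Xr.
  by move=> /(inj s r s1' st1 t1r (ltW r1')) rs; rewrite rs ltxx in sr.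
(* No point of the curve lies strictly between [F s] and [F r] on the line [x = c]. *)
have gap t u : 0 < u < 1 -> F t = (c, Y s + u * (Y r - Y s)) -> False.
  move=> /andP[u0 u1] Et.
  have [t' [/andP[t'1 t'2] E]] := loop_shift t1 t lF; rewrite Et in E.
  have Xt' : X t' = c by rewrite /X E.
  have Yt' : Y t' = Y s + u * (Y r - Y s) by rewrite /Y E.
  have d0 : 0 < `|Y s - Y r| by rewrite normr_gt0 subr_eq0; exact/eqP.
  have [tt|tt] := leP t' t2.
    have := Hmin (t', r); rewrite /= Yt'.
    have -> : Y s + u * (Y r - Y s) - Y r = (1 - u) * (Y s - Y r) by ring.
    rewrite normrM (ger0_norm (_ : 0 <= 1 - u)); last by lra.
    move=> H; have : `|Y s - Y r| <= (1 - u) * `|Y s - Y r|.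
      by apply: H; split => //; [rewrite t'1|rewrite r2].
    by nra.
  have := Hmin (s, t'); rewrite /= Yt'.
  have -> : Y s - (Y s + u * (Y r - Y s)) = u * (Y s - Y r) by ring.
  rewrite normrM (ger0_norm (_ : 0 <= u)); last by lra.
  move=> H; have : `|Y s - Y r| <= u * `|Y s - Y r|.
    by apply: H; split => //; [rewrite s1|rewrite !ltW].
  by nra.
pose x4 : R * R := (c, Y s + 1 / 2 * (Y r - Y s)).
pose x5 : R * R := (c, Y ty + 1).
pose tv i := if i is 0 then F t1 else if i is 1 then F t2 else x4.
pose sv i := if i is 0 then F s else if i is 1 then F r else x5.
pose between (a b : R) : set (R * R) := [set z | exists u, a <= u <= b /\ z = (c, Y s + u * (Y r - Y s))].
(* Edges with a common vertex may overlap. The two outer edges, which both end at [x5], share the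
   region above the curve, and the edge from [x4] to [x5] may be the whole complement of [J], since
   it has to avoid only the four arcs. *)
pose S i j : set (R * R) := match i, j with
  | 0, 0 => F @` `[t1, s]
  | 0, 1 => F @` `[r, t1 + 1]
  | 0, _ => [set z | z = F t1 \/ z.1 < X t1 \/ Y ty < z.2]
  | 1, 0 => F @` `[s, t2]
  | 1, 1 => F @` `[t2, r]
  | 1, _ => [set z | z = F t2 \/ X t2 < z.1 \/ Y ty < z.2]
  | _, 0 => between 0 (1 / 2)
  | _, 1 => between (1 / 2) 1
  | _, _ => ~` J
  end.
have arcJ a b z : (F @` `[a, b]) z -> J z by rewrite EJ => -[t _ <-]; exists t.
have nJ z : ~ J z <-> forall t, F t <> z.
  by rewrite EJ; split=> [H t E|H [t _ E]]; [apply: H; exists t|exact: (H t)].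
have Y4 u : 0 <= u <= 1 -> Y s + u * (Y r - Y s) <= Y ty.
  by move=> /andP[u0 u1]; have := Ymax s; have := Ymax r; nra.
have J4 : ~ J x4 by apply/nJ => t; apply: gap; apply/andP; split; lra.
have J5 : ~ J x5.
  apply/nJ => t E; have := Ymax t; rewrite /Y E /= ; lra.
apply: (@K33_sets R tv sv S).
  move=> i j; case: i => [|[|[|//]]] _; case: j => [|[|[|//]]] _.
  - exact: path_in_arc.
  - rewrite /S /tv /sv -F11; apply: path_in_sym; apply: path_in_arc => //; exact: ltW.
  - apply: (@path_in_trans _ _ _ (X t1 - 1, Y t1)).
      apply: path_in_line => t /andP[t0 _] /=.
      rewrite -/(X t1) -/(Y t1).
      have [->|tn] := eqVneq t 0; first by left; rewrite !mul0r !addr0 -surjective_pairing.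
      by have tp : 0 < t by [rewrite lt_neqAle eq_sym tn]; right; left; lra.
    apply: (@path_in_trans _ _ _ (X t1 - 1, Y ty + 1)).
      by apply: path_in_line => t _ /=; right; left; lra.
    by apply: path_in_line => t _ /=; right; right; lra.
  - by apply: path_in_sym; exact: path_in_arc.
  - exact: path_in_arc.
  - apply: (@path_in_trans _ _ _ (X t2 + 1, Y t2)).
      apply: path_in_line => t /andP[t0 _] /=.
      rewrite -/(X t2) -/(Y t2).
      have [->|tn] := eqVneq t 0; first by left; rewrite !mul0r !addr0 -surjective_pairing.
      by have tp : 0 < t by [rewrite lt_neqAle eq_sym tn]; right; left; lra.
    apply: (@path_in_trans _ _ _ (X t2 + 1, Y ty + 1)).
      by apply: path_in_line => t _ /=; right; left; lra.
    by apply: path_in_line => t _ /=; right; right; lra.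
  - apply: path_in_line => t /andP[t0' t1'] /=; rewrite -/(X s) -/(Y s) Xs.
    exists (1 / 2 * (1 - t)); split; first by apply/andP; split; lra.
    by congr pair; ring.
  - apply: path_in_line => t /andP[t0' t1'] /=; rewrite -/(X r) -/(Y r) Xr.
    exists (1 / 2 * (1 + t)); split; first by apply/andP; split; lra.
    by congr pair; field.
  - exact: conn.
(* Interior points of the vertical segment are excluded by [gap]. Its ends are the curve points
   [F s] and [F r], which need an argument of their own when the edge reaches them. *)
have betw_arc a b (u0 u1 : R) z : 0 <= u0 -> u1 <= 1 -> (u0 = 0 -> u1 < 1 /\ ~ (F @` `[a, b]) (F s)) ->
    (u1 = 1 -> 0 < u0 /\ ~ (F @` `[a, b]) (F r)) -> between u0 u1 z -> (F @` `[a, b]) z -> False.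
  move=> h0 h1 hs hr [u [/andP[ua ub] ->]] [t tab E].
  have [u00|u00] := eqVneq u 0.
    have [|_] := hs; first by apply/eqP; rewrite eq_le h0 andbT -u00.
    by apply; exists t => //; rewrite E u00 mul0r addr0 [F s]surjective_pairing -/(X s) Xs.
  have [u11|u11] := eqVneq u 1.
    have [|_] := hr; first by apply/eqP; rewrite eq_le h1 -u11.
    by apply; exists t => //; rewrite E u11 mul1r subrKC [F r]surjective_pairing -/(X r) Xr.
  have u01 : 0 < u < 1.
    by rewrite !lt_neqAle u11 eq_sym u00 /= (le_trans h0 ua) (le_trans ub h1).
  exact: gap u01 E.
have pt_out p a b : t1 < p -> p < t1 + 1 -> t1 <= a -> b <= t1 + 1 -> p < a \/ b < p ->
    ~ (F @` `[a, b]) (F p).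
  move=> p1 p2 a1 b1 pab [t]; rewrite /= in_itv /= => /andP[ta tb] E.
  have pt : p = t := inj p t p1 p2 (le_trans a1 ta) (le_trans tb b1) (esym E).
  case: pab; rewrite pt => h; first by have := lt_le_trans h ta; rewrite ltxx.
  by have := le_lt_trans tb h; rewrite ltxx.
have out1 a b z : t1 < a -> b < t1 + 1 -> S 0%N 2%N z -> (F @` `[a, b]) z -> False.
  move=> a1 b1 Sz [t + E]; rewrite /= in_itv /= -{}E in Sz * => /andP[ta tb].
  case: Sz => [E|[H|H]].
  - have ta1 := lt_le_trans a1 ta.
    have := inj t t1 ta1 (le_lt_trans tb b1) (lexx _) (ltW (lt_trans s1' st1)) E.
    by move=> tt; rewrite tt ltxx in ta1.
  - by have := le_lt_trans (Xmin t) H; rewrite ltxx.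
  - by have := le_lt_trans (Ymax t) H; rewrite ltxx.
have out2 a b z : t1 <= a -> b <= t1 + 1 -> t2 < a \/ b < t2 -> S 1%N 2%N z ->
    (F @` `[a, b]) z -> False.
  move=> a1 b1 h Sz Az; case: (Sz) => [E|].
    by apply: (pt_out t2 a b) => //; rewrite -E.
  case: Az => t _ <- [H|H].
    by have := le_lt_trans (Xmax t) H; rewrite ltxx.
  by have := le_lt_trans (Ymax t) H; rewrite ltxx.
have outb (u0 u1 : R) z : 0 <= u0 -> u1 <= 1 -> between u0 u1 z -> S 0%N 2%N z \/ S 1%N 2%N z -> False.
  move=> h0 h1 [u [/andP[ua ub] ->]] /=.
  have Yu : Y s + u * (Y r - Y s) <= Y ty by apply: Y4; rewrite (le_trans h0 ua) (le_trans ub h1).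
  rewrite [F t1]surjective_pairing [F t2]surjective_pairing -/(X t1) -/(X t2).
  case=> [[[E _]|[H|H]]|[[E _]|[H|H]]].
  - by rewrite E ltxx in c1.
  - by have := lt_trans H c1; rewrite ltxx.
  - by have := le_lt_trans Yu H; rewrite ltxx.
  - by rewrite E ltxx in c2.
  - by have := lt_trans H c2; rewrite ltxx.
  - by have := le_lt_trans Yu H; rewrite ltxx.
have disjE (A B : set (R * R)) z : A `&` B = set0 -> A z -> B z -> set0 z by move=> <-.
have h0 : 0 < 1 / 2 :> R by rewrite divr_gt0.
have h1 : 1 / 2 < 1 :> R by rewrite ltr_pdivrMr// mul1r ltr1n.
have h0' : (1 / 2 : R) <> 0 by move=> E; rewrite E ltxx in h0.
have h1' : (1 / 2 : R) <> 1 by move=> E; rewrite E ltxx in h1.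
have betw1 a b z : t1 <= a -> b <= t1 + 1 -> r < a \/ b < r ->
    (F @` `[a, b]) z -> between (1 / 2) 1 z -> set0 z.
  move=> a1 b1 rab az bz; apply: (betw_arc a b _ _ z (ltW h0) (lexx _) _ _ bz az) => //.
  by move=> _; split; [exact: h0|exact: pt_out].
have betw0 a b z : t1 <= a -> b <= t1 + 1 -> s < a \/ b < s ->
    (F @` `[a, b]) z -> between 0 (1 / 2) z -> set0 z.
  move=> a1 b1 sab az bz; apply: (betw_arc a b _ _ z (lexx _) (ltW h1) _ _ bz az) => //.
  by move=> _; split; [exact: h1|exact: pt_out].
have [d1 d2 d3 d4] : [/\ r - t1 < 1, s - t2 < 1, t1 + 1 - s < 1 & t2 - r < 1].
  by move: s1' s2' r1' r2'; clear; move=> *; split; lra.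
move=> i j k l; case: i => [|[|[|//]]]; case: k => [|[|[|//]]]// _;
  case: j => [|[|[|//]]] _ _; case: l => [|[|[|//]]] _ // _;
  apply/seteqP; split=> // z [Sz Sz'].
- exact: disjE (arcs_disjoint lF d1 d2 s2') Sz Sz'.
- by apply: (out2 t1 s z) => //; right.
- exact: disjE (arcs_disjoint lF d3 d4 r2') Sz' Sz.
- by apply: (out2 r (t1 + 1) z) => //; left.
- exact: (out1 s t2 z).
- exact: (out1 t2 r z).
- by apply: (betw1 t1 s) => //; right.
- exact: Sz' (arcJ _ _ _ Sz).
- by apply: (betw0 r (t1 + 1)) => //; left.
- exact: Sz' (arcJ _ _ _ Sz).
- exact: (outb 0 (1 / 2) z (lexx _) (ltW h1) Sz' (or_introl Sz)).
- exact: (outb (1 / 2) 1 z (ltW h0) (lexx _) Sz' (or_introl Sz)).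
- by apply: (betw1 s t2) => //; right.
- exact: Sz' (arcJ _ _ _ Sz).
- by apply: (betw0 t2 r) => //; left.
- exact: Sz' (arcJ _ _ _ Sz).
- exact: (outb 0 (1 / 2) z (lexx _) (ltW h1) Sz' (or_intror Sz)).
- exact: (outb (1 / 2) 1 z (ltW h0) (lexx _) Sz' (or_intror Sz)).
Qed.

End Jordan.

(** * Components of compact sets as quasi-components *)

Section Quasi.
Context {R : realType} {T : pseudoMetricType R}.
Hypothesis hT : hausdorff_space T.
Variables (X : set T) (p : T).
Hypotheses (cX : compact X) (Xp : X p).

(** Relative clopenness in [X], expressed by closedness in [T]: this is equivalent because [X] is
    compact, hence closed. *)
Definition clopen_at (N : set T) := [/\ N p, N `<=` X, closed N & closed (X `\` N)].

Definition quasi_component : set T := \bigcap_(N in clopen_at) N.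

Lemma closed_space : closed X. Proof. exact: compact_closed. Qed.

Lemma clopen_atX : clopen_at X.
Proof. by split=> //; [exact: closed_space|rewrite setDv; exact: closed0]. Qed.

Lemma clopen_atI N M : clopen_at N -> clopen_at M -> clopen_at (N `&` M).
Proof.
move=> [Np NX cN cN'] [Mp MX cM cM']; split=> //.
- by move=> x [/NX].
- exact: closedI.
- by rewrite setDIr; exact: closedU.
Qed.

(** Otherwise the traces on [Y] of the clopen sets around [p] generate a proper filter, and a
    cluster point lies in all of them. *)
Lemma quasi_component_avoid (Y : set T) : closed Y -> quasi_component `&` Y = set0 ->
  exists2 N, clopen_at N & N `&` Y = set0.
Proof.
move=> cY QY; apply: contrapT => H.
have ne N : clopen_at N -> N `&` Y !=set0.
  by move=> cN; apply/set0P/eqP => E; apply: H; exists N.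
pose F := filter_from clopen_at (fun N => N `&` Y).
have FF : ProperFilter F.
  apply: filter_from_proper; last exact: ne.
  apply: filter_from_filter; first by exists X; exact: clopen_atX.
  move=> N M cN cM; exists (N `&` M); first exact: clopen_atI.
  by move=> x [[Nx Mx] Yx].
have [|x [Xx clx]] := cX FF.
  by exists X; [exact: clopen_atX|move=> x []].
have xN N : clopen_at N -> (N `&` Y) x.
  move=> cN; have [_ _ clN _] := cN.
  rewrite (closure_id (N `&` Y)).1; last exact: closedI.
  by move=> B nB; apply: clx => //; exists N.
suff : (quasi_component `&` Y) x by rewrite QY.
split; last by case: (xN _ clopen_atX).
by move=> N /xN[].
Qed.

(** If it split into two closed pieces, disjoint open neighbourhoods [U], [V] of these would cover a
    clopen set [N] around [p]. The part of [N] in whichever of [U], [V] contains [p] is again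
    clopen, yet misses one piece. *)
Lemma quasi_component_connected : connected quasi_component.
Proof.
apply: contrapT => /connectedPn[E [E0 QE [s1 s2]]].
have cQ : closed quasi_component by apply: closed_bigI => N [].
have EQ b : E b `<=` quasi_component by move=> x Ex; rewrite QE; case: b Ex; [right|left].
have cE b : closed (E b).
  move=> x clx; have : quasi_component x.
    by rewrite (closure_id quasi_component).1//; exact: closureS clx.
  rewrite QE => -[Ex|Ex]; case: b clx => // clx; exfalso.
    by rewrite -[False]/(set0 x) -s2.
  by rewrite -[False]/(set0 x) -s1.
have EE : E false `&` E true = set0.
  by apply/seteqP; split=> // x [Ex Ex']; rewrite -s2; split=> //; exact: subset_closure.
have /(@normal_openP R) nT := @pseudometric_normal R T.
have [U [V [oU oV EU EV UV]]] := nT _ _ (cE false) (cE true) EE.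
have cY : closed (~` (U `|` V)) by apply: open_closedC; exact: openU.
have QY : quasi_component `&` ~` (U `|` V) = set0.
  apply/seteqP; split=> // x [+ nUV]; rewrite QE => -[/EU Ux|/EV Vx]; apply: nUV; [left|right] => //.
have [N [Np NX cN cN'] NUV] := quasi_component_avoid cY QY.
have NUV' x : N x -> U x \/ V x.
  move=> Nx; apply: contrapT => nUV; rewrite -[False]/(set0 x) -NUV; split=> //.
have main (U' V' : set T) : open U' -> open V' -> U' `&` V' = set0 ->
    (forall x, N x -> U' x \/ V' x) -> U' p -> quasi_component `<=` U'.
  move=> oU' oV' UV' H U'p.
  suff cNU : clopen_at (N `&` U') by move=> x /(_ _ cNU)[].
  split=> //; first by move=> x [/NX].
    have -> : N `&` U' = N `&` ~` V'.
      apply/seteqP; split=> x [Nx Hx]; split=> //; last by case: (H _ Nx).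
      by move=> Vx; rewrite -[False]/(set0 x) -UV'.
    by apply: closedI => //; exact: open_closedC.
  have -> : X `\` (N `&` U') = (X `\` N) `|` (X `&` ~` U').
    by rewrite setDIr setDE.
  apply: closedU => //; apply: closedI; first exact: closed_space.
  exact: open_closedC.
have dUV x : U x -> V x -> False by move=> Ux Vx; rewrite -[False]/(set0 x) -UV.
have [Up|Vp] := NUV' _ Np.
  have [x Ex] := E0 true; apply: (dUV x); last exact: EV.
  by apply: (main U V) => //; exact: EQ Ex.
have [x Ex] := E0 false; apply: (dUV x); first exact: EU.
apply: (main V U) => //; [by rewrite setIC| |exact: EQ Ex].
by move=> z /NUV'[]; [right|left].
Qed.

Lemma component_avoid (Y : set T) : closed Y -> connected_component X p `&` Y = set0 ->
  exists N, [/\ N p, N `<=` X, closed N, closed (X `\` N) & N `&` Y = set0].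
Proof.
move=> cY CY; have [|N [? ? ? ?] NY] := quasi_component_avoid cY; last by exists N.
apply/seteqP; split=> // x [Qx Yx]; rewrite -CY; split=> //.
apply: (connected_component_max (B := quasi_component)) => //.
- by move=> N [].
- by move=> z /(_ X clopen_atX).
- exact: quasi_component_connected.
Qed.

End Quasi.

(** * Jordan separation on the sphere *)

Section SphereJordan.
Context {R : realType}.
Implicit Types (p q : pt R) (J : set (pt R)).
Local Notation S2 := (@S2 R).

Lemma curve_closed J : simple_closed_curve J -> closed J.
Proof. by move=> /loop_paramP[_ [F lF]]; exact: loop_closed lF. Qed.

Lemma curve_nonempty J : simple_closed_curve J -> J !=set0.
Proof. by move=> /loop_paramP[_ [F [_ _ _ ->]]]; exists (F 0); exists 0. Qed.

(** Projection from [o] identifies the planar complement of the curve with the spherical one without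
    [o]. A connected spherical complement would stay connected without [o], so the planar one would
    be path connected, against [loop_separates]. *)
Lemma curve_separates J o : simple_closed_curve J -> (S2 `\` J) o ->
  exists2 b, (S2 `\` J) b & ~ connected_component (S2 `\` J) b o.
Proof.
move=> scJ [So nJo]; have cJ := curve_closed scJ.
have [JS [F lF]] := loop_paramP scJ; have [cF Fper Finj EJ] := lF.
apply: contrapT => H.
have all b : (S2 `\` J) b -> connected_component (S2 `\` J) b o.
  by move=> Jb; apply: contrapT => nb; apply: H; exists b.
have oS : sphere_open (S2 `\` J) by exact: sphere_openD.
have cS : connected (S2 `\` J).
  have -> : S2 `\` J = connected_component (S2 `\` J) o; last exact: component_connected.
  apply/seteqP; split; last exact: connected_component_sub.
  by move=> b /all/connected_component_sym.
have cO := punctured_connected (o := o) oS cS.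
have [phi [psi ch]] := stereographic_chart So; have oA := chart_open ch oS.
case: ch => cpsi psiS phiK psiK.
have SF t : S2 (F t) by apply: JS; rewrite EJ; exists t.
have Fo t : F t <> o by move=> E; apply: nJo; rewrite EJ; exists t.
have lG : loop_param (fun t => phi (F t)) (range (fun t => phi (F t))).
  split=> //.
  - move=> t; have cp := (psiK _ (SF t) (Fo t)).2.
    exact: (continuous_after cp (cF t)).
  - by move=> t; rewrite Fper.
  - move=> s t st E; apply: Finj => //.
    by rewrite -(psiK _ (SF s) (Fo s)).1 E (psiK _ (SF t) (Fo t)).1.
apply: (loop_separates lG) => a b na nb.
have EA : ~` range (fun t => phi (F t)) = psi @^-1` (S2 `\` J).
  apply/seteqP; split=> w /=.
    move=> nw; split; first exact: (psiS w).1.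
    by rewrite EJ => -[t _ E]; apply: nw; exists t => //; rewrite E phiK.
  move=> [_ nw] [t _ E]; apply: nw; rewrite EJ; exists t => //.
  by rewrite -E (psiK _ (SF t) (Fo t)).1.
apply: open_path => //; first by rewrite EA.
rewrite EA; have -> : psi @^-1` (S2 `\` J) = phi @` ((S2 `\` J) `\ o).
  apply/seteqP; split=> [w Jw|_ [q [[Sq nJq] qo] <-]].
    by exists (psi w); [split=> //; exact: (psiS w).2|exact: phiK].
  by rewrite /= (psiK _ Sq qo).1; split.
apply: connected_continuous_connected => //.
by apply: within_for => q [[Sq _] qo]; exact: (psiK _ Sq qo).2.
Qed.

Lemma curve_other_side J o : simple_closed_curve J -> (S2 `\` J) o ->
  exists2 b, (S2 `\` J) b & ~ connected_component (S2 `\` J) b o /\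
    J `<=` closure (connected_component (S2 `\` J) b).
Proof.
move=> scJ Jo; have [b Jb nb] := curve_separates scJ Jo; exists b => //; split=> //.
by have [JS [F lF]] := loop_paramP scJ; exact: curve_boundary lF JS Jb Jo nb.
Qed.

End SphereJordan.

(** * Domains bounded by disjoint curves *)

Section Domain.
Context {R : realType}.
Implicit Types (p q x y : pt R).
Local Notation S2 := (@S2 R).

Lemma open_not_boundary (W : set (pt R)) p : sphere_open W -> W p -> ~ sphere_boundary W p.
Proof.
move=> oW Wp [_ cl]; have [q [[Sq nWq] Hq]] := cl _ (sphere_open_near oW Wp).
exact: nWq (Hq Sq).
Qed.

Lemma closure_sphere_open (W : set (pt R)) p : sphere_open W -> closure W p ->
  W p \/ sphere_boundary W p.
Proof.
move=> oW clp; have Sp : S2 p.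
  rewrite (closure_id S2).1; last exact: closed_S2.
  exact: (closureS (sphere_open_sub oW)) clp.
by have [Wp|nWp] := pselect (W p); [left|right; split=> //; exact: subset_closure].
Qed.

(** Near [p] the sphere lies in the component of [p], and [W] comes that near. This locates curves
    known only to be adherent to a connected set. *)
Lemma adherent_component (O W : set (pt R)) w p : sphere_open O -> connected W -> W `<=` O ->
  W w -> O p -> closure W p -> connected_component O w p.
Proof.
move=> oO cW WO Ww Op clp.
have [q [Wq Hq]] := clp _ (sphere_locally_connected oO Op).
apply: connected_component_trans (connected_component_sym (Hq (sphere_open_sub oO (WO _ Wq)))).
by apply/connected_componentP; exists W.
Qed.

Section CurveDomain.
Variables (W : set (pt R)) (n : nat) (G : nat -> set (pt R)) (w : pt R).
Hypotheses (n2 : (2 <= n)%N) (oW : sphere_open W) (cW : connected W) (Ww : W w).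
Hypothesis curveG : forall i, (i < n)%N -> simple_closed_curve (G i).
Hypothesis disjG : forall i j, (i < n)%N -> (j < n)%N -> i <> j -> G i `&` G j = set0.
Hypothesis bdW : sphere_boundary W = \bigcup_(i in [set i : nat | (i < n)%N]) G i.

Let WS : W `<=` S2 := sphere_open_sub oW.

Let disj (X Y : set (pt R)) p : X `&` Y = set0 -> X p -> Y p -> False.
Proof. by move=> XY Xp Yp; rewrite -[False]/(set0 p) -XY. Qed.

Lemma domain_off_curve i p : (i < n)%N -> W p -> ~ G i p.
Proof.
move=> ilt Wp Gp; apply: open_not_boundary oW Wp _.
by rewrite bdW; exists i.
Qed.

Lemma curve_adherent i : (i < n)%N -> G i `<=` closure W.
Proof. by move=> ilt p Gp; have [] : sphere_boundary W p by rewrite bdW; exists i. Qed.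

Lemma curve_sub_sphere i : (i < n)%N -> G i `<=` S2.
Proof. by move=> /curveG[]. Qed.

Definition side i := connected_component (S2 `\` G i) w.
(** The closed set that [G i] cuts off from [W], with [G i] included. Its complement [side i] is
    connected, so a single one does not separate the sphere. *)
Definition disc i := S2 `\` side i.

Lemma curve_complement_open i : (i < n)%N -> sphere_open (S2 `\` G i).
Proof. by move=> /curveG/curve_closed; exact: sphere_openD. Qed.

Lemma domain_sub_complement i : (i < n)%N -> W `<=` S2 `\` G i.
Proof. by move=> ilt p Wp; split; [exact: WS|exact: domain_off_curve]. Qed.

Lemma side_open i : (i < n)%N -> sphere_open (side i).
Proof. by move=> /curve_complement_open; exact: component_sphere_open. Qed.

Lemma domain_sub_side i : (i < n)%N -> W `<=` side i.
Proof. by move=> ilt; apply: connected_component_max => //; exact: domain_sub_complement. Qed.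

Lemma curve_in_side i j : (i < n)%N -> (j < n)%N -> i <> j -> G i `<=` side j.
Proof.
move=> il jl ij p Gp; apply: (adherent_component (W := W)) => //.
- exact: curve_complement_open.
- exact: domain_sub_complement.
- by split; [exact: curve_sub_sphere Gp|exact: disj (disjG il jl ij) Gp].
- exact: curve_adherent Gp.
Qed.

Lemma curve_in_disc i : (i < n)%N -> G i `<=` disc i.
Proof.
move=> il p Gp; split; first exact: curve_sub_sphere Gp.
by move/connected_component_sub => -[].
Qed.

Lemma disc_closed i : (i < n)%N -> closed (disc i).
Proof. by move=> /side_open; exact: closed_sphereD. Qed.

(** A component of the complement of [G i] other than [side i] misses [G j], which lies in [side i].
    It is adherent to [G i], which lies in [side j], so it lies in [side j] too. *)
Lemma disc_in_side i j : (i < n)%N -> (j < n)%N -> i <> j -> disc i `<=` side j.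
Proof.
move=> il jl ij x [Sx nx].
have [Gx|nGx] := pselect (G i x); first exact: curve_in_side Gx.
have [JS [F lF]] := loop_paramP (curveG il).
have Jw := domain_sub_complement il Ww.
have GC : G i `<=` closure (connected_component (S2 `\` G i) x).
  apply: (curve_boundary lF JS) Jw _ => //.
  by move=> /connected_component_sym.
have [p Gp] := curve_nonempty (curveG il).
have CO : connected_component (S2 `\` G i) x `<=` S2 `\` G j.
  move=> q Cq; split; first by have [] := connected_component_sub Cq.
  move=> /(curve_in_side jl il (nesym ij)) wq; apply: nx.
  exact: connected_component_trans wq (connected_component_sym Cq).
have wp := curve_in_side il jl ij Gp.
have xp : connected_component (S2 `\` G j) x p.
  apply: (adherent_component (W := connected_component (S2 `\` G i) x)) => //.
  - exact: curve_complement_open.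
  - exact: component_connected.
  - exact: connected_component_refl.
  - exact: connected_component_sub wp.
  - exact: GC.
exact: connected_component_trans wp (connected_component_sym xp).
Qed.

Lemma disc_disjoint i j : (i < n)%N -> (j < n)%N -> i <> j -> disc i `&` disc j = set0.
Proof.
by move=> il jl ij; apply/seteqP; split=> // p [/(disc_in_side il jl ij) sp [_ nsp]].
Qed.

Let discs k : set (pt R) := [set p | exists i, (i < k)%N /\ disc i p].

Let discsS k : discs k.+1 = discs k `|` disc k.
Proof.
apply/seteqP; split=> p.
  move=> [i []]; rewrite ltnS leq_eqVlt => /orP[/eqP ->|ik] Dp; first by right.
  by left; exists i.
by move=> [[i [ik Dp]]|Dp]; [exists i; rewrite ltnS ltnW|exists k].
Qed.

Let discs_closed k : (k <= n)%N -> closed (discs k).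
Proof.
elim: k => [_|k IH kn].
  suff -> : discs 0 = set0 by exact: closed0.
  by apply/seteqP; split=> // p [i []]; rewrite ltn0.
by rewrite discsS; apply: closedU; [exact/IH/ltnW|exact: disc_closed].
Qed.

(** Induction by Janiszewski's theorem: the discs already treated and the next one are disjoint
    closed sets, neither of which separates [w] from [u]. *)
Lemma discs_not_separate k u : (0 < k <= n)%N -> (forall i, (i < n)%N -> side i u) ->
  connected_component (S2 `\` discs k) w u.
Proof.
move=> /andP[k0 kn] Bu.
have n0 : (0 < n)%N by exact: ltn_trans n2.
elim: k k0 kn => // k IH _ kn; have [->|k0] := posnP k.
  have -> : S2 `\` discs 1 = side 0%N; last first.
    by rewrite connected_component_id; [exact: Bu|exact: domain_sub_side|exact: component_connected].
  apply/seteqP; split=> p.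
    by move=> [Sp nD]; apply: contrapT => np; apply: nD; exists 0%N.
  move=> sp; split; first by have [] := connected_component_sub sp.
  by move=> [i [+ [_ nsp]]]; rewrite ltnS leqn0 => /eqP i0; apply: nsp; rewrite i0.
move: IH => /(_ k0 (ltnW kn)) IH.
(* The pole has to lie in one of the two closed sets; a point of [G 0] is in the first as [0 < k].
   It also lies in [side k], which must therefore be punctured. *)
case: (curve_nonempty (curveG n0)) => o Go.
have Do : discs k o by exists 0%N; split=> //; exact: curve_in_disc.
have So := curve_sub_sphere n0 Go.
have off v : (forall i, (i < n)%N -> side i v) -> v <> o.
  by move=> /(_ 0%N n0) sv E; have [_] := curve_in_disc n0 Go; rewrite -E.
have Bw i : (i < n)%N -> side i w by move=> il; exact: domain_sub_side.
have C1w : connected_component (S2 `\` discs k) w w.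
  by have /connected_componentP[C [? CS ? ?]] := IH; apply: connected_component_refl; exact: CS.
rewrite discsS.
apply: (@janiszewski_sphere R _ _ (connected_component (S2 `\` discs k) w) (side k `\ o) o) => //.
- exact/discs_closed/ltnW.
- exact: disc_closed.
- by left.
- move=> p [[i [ik Di]] Dk]; exfalso.
  apply: (disj _ Di Dk); apply: disc_disjoint => //; first exact: ltn_trans kn.
  by move=> E; rewrite E ltnn in ik.
- exact: component_connected.
- by apply: punctured_connected; [exact: side_open|exact: component_connected].
- exact: connected_component_sub.
- move=> p [sp _]; split; first by have [] := connected_component_sub sp.
  by move=> [_]; apply.
- by move/connected_component_sub => [_]; apply.
- by move=> [_]; apply.
- by split; [exact: Bw|exact: off].
- by split; [exact: Bu|exact: off].
Qed.

(** [W] is open and closed in the complement of the discs, since its boundary lies on the curves,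
    and a connected subset of that complement joins [w] to [u]. *)
Lemma domain_eq u : (forall i, (i < n)%N -> side i u) -> W u.
Proof.
move=> Bu; have nn : (0 < n <= n)%N by rewrite leqnn andbT (ltn_trans _ n2).
have /connected_componentP[C [cC CS Cw Cu]] := discs_not_separate nn Bu.
apply: (@sphere_connected_split R C W (S2 `\` closure W)) Cu => //.
- by move=> p /CS[].
- exact/sphere_openD/closed_closure.
- move=> p Cp; have [Sp nD] := CS _ Cp.
  have [clp|nclp] := pselect (closure W p); last by right.
  have [Wp|] := closure_sphere_open oW clp; first by left.
  by rewrite bdW => -[i il Gp]; case: nD; exists i; split=> //; exact: curve_in_disc.
- by apply/seteqP; split=> // p [Wp [_]]; apply; exact: subset_closure.
- by exists w.
Qed.

Definition annulus := connected_component (S2 `\` (G 0%N `|` G 1%N)) w.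

Let n0 : (0 < n)%N := ltnW n2.

Lemma annulus_complement_open : sphere_open (S2 `\` (G 0%N `|` G 1%N)).
Proof. by apply: sphere_openD; apply: closedU; apply: curve_closed; exact: curveG. Qed.

Lemma annulus_open : sphere_open annulus.
Proof. exact/component_sphere_open/annulus_complement_open. Qed.

Lemma domain_sub_annulus : W `<=` annulus.
Proof.
apply: connected_component_max => // p Wp; split; first exact: WS.
by case; [exact: domain_off_curve Wp|exact: domain_off_curve Wp].
Qed.

Lemma annulus_boundary : sphere_boundary annulus = G 0%N `|` G 1%N.
Proof.
apply/seteqP; split=> p.
  move=> bp; have [clp clp'] := bp; apply: contrapT => nG.
  have Sp : S2 p.
    rewrite (closure_id S2).1; last exact: closed_S2.
    exact: (closureS (sphere_open_sub annulus_open)) clp.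
  apply: open_not_boundary annulus_open _ bp.
  apply: (adherent_component (W := annulus)) => //.
  - exact: annulus_complement_open.
  - exact: component_connected.
  - exact: connected_component_sub.
  - exact: domain_sub_annulus.
have sub i : (i < n)%N -> G i `<=` G 0%N `|` G 1%N -> G i `<=` sphere_boundary annulus.
  move=> il iG q Gq; split.
    exact: (closureS domain_sub_annulus) (curve_adherent il Gq).
  apply: subset_closure; split; first exact: curve_sub_sphere Gq.
  by move/connected_component_sub => [_]; apply; exact: iG.
by case=> Gp; [exact: (sub 0%N n0 (@subsetUl _ _ _) _ Gp)|exact: (sub 1%N n2 (@subsetUr _ _ _) _ Gp)].
Qed.

Lemma annulus_betweenP : annulus_between (G 0%N) (G 1%N) annulus.
Proof.
split; last exact: annulus_boundary.
by exists w => //; exact: connected_component_sub (domain_sub_annulus Ww).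
Qed.

(** By [domain_eq], points of the annulus outside the discs of index at least 2 belong to [W]; these
    finitely many closed discs all miss [p]. *)
Lemma annulus_near_domain p : closure W p -> (forall i, (2 <= i < n)%N -> ~ G i p) ->
  \forall q \near p, annulus q -> W q.
Proof.
move=> clp nG.
have ndisc i : (2 <= i)%N -> (i < n)%N -> \forall q \near p, ~ disc i q.
  move=> i2 il; apply: open_nbhs_nbhs; split; first exact/closed_openC/disc_closed.
  have [Wp|] := closure_sphere_open oW clp; first by move=> [_]; apply; exact: domain_sub_side.
  rewrite bdW => -[j jl Gp] [_]; apply; apply: curve_in_side (Gp) => // E.
  by apply: (nG i); rewrite ?i2// -E.
have : \forall q \near p, forall i, (2 <= i)%N -> (i < n)%N -> ~ disc i q.
  have : forall k, (k <= n)%N -> \forall q \near p, forall i, (2 <= i)%N -> (i < k)%N -> ~ disc i q.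
    elim=> [_|k IH kn]; first by apply: filterE => q i.
    have [k2|k2] := leqP 2 k; last first.
      by apply: filterE => q i i2 ik; have := leq_trans ik k2; rewrite ltnNge i2.
    apply: filterS2 (IH (ltnW kn)) (ndisc k k2 kn) => q H1 H2 i i2.
    by rewrite ltnS leq_eqVlt => /orP[/eqP ->//|]; exact: H1.
  by move/(_ n (leqnn n)).
apply: filterS => q nD Aq; apply: domain_eq => i il.
have Sq : S2 q by have [] := connected_component_sub Aq.
have [i2|] := leqP 2 i.
  by apply: contrapT => nq; apply: (nD i) => //.
have sub i' : (i' < n)%N -> G i' `<=` G 0%N `|` G 1%N -> side i' q.
  move=> il' iG; apply: (connected_component_max (B := annulus)) Aq.
  - exact: domain_sub_annulus.
  - move=> z /connected_component_sub[Sz nz]; split=> // Gz; apply: nz; exact: iG.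
  - exact: component_connected.
by case: i il => [|[|//]] il _; [exact: (sub 0%N il (@subsetUl _ _ _))|exact: (sub 1%N il (@subsetUr _ _ _))].
Qed.

(** * Components of the traces of [K] on the closed domain and the closed annulus *)

Section Components.
Variable K : set (pt R).
Hypothesis kK : compact K.

Let Z := closure W `&` K.

Lemma trace_compact : compact Z.
Proof. by rewrite /Z setIC; apply: compact_closedI => //; exact: closed_closure. Qed.

(** A clopen part [N] of [Z] around the component and off the other curves is also relatively clopen
    in the larger trace, so the larger component cannot leave [N] and hence stays in [Z]. *)
Lemma trace_component_annulus p : Z p ->
  (forall i, (2 <= i < n)%N -> connected_component Z p `&` G i = set0) ->
  connected_component (closure annulus `&` K) p = connected_component Z p.
Proof.
move=> Zp avoid.
pose Y : set (pt R) := [set q | exists2 i, (2 <= i < n)%N & G i q].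
have cY : closed Y.
  have : forall k, (k <= n)%N -> closed [set q : pt R | exists2 i, (2 <= i < k)%N & G i q].
    elim=> [_|k IH kn].
      suff -> : [set q : pt R | exists2 i, (2 <= i < 0)%N & G i q] = set0 by exact: closed0.
      by apply/seteqP; split=> // q [i]; rewrite ltn0 andbF.
    have [k2|k2] := leqP 2 k; last first.
      suff -> : [set q : pt R | exists2 i, (2 <= i < k.+1)%N & G i q] = set0 by exact: closed0.
      by apply/seteqP; split=> // q [i /andP[i2 ik]]; have := leq_trans ik k2; rewrite ltnNge i2.
    have -> : [set q : pt R | exists2 i, (2 <= i < k.+1)%N & G i q] =
        [set q | exists2 i, (2 <= i < k)%N & G i q] `|` G k.
      apply/seteqP; split=> q.
        move=> [i /andP[i2]]; rewrite ltnS leq_eqVlt => /orP[/eqP ->|ik] Gq; first by right.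
        by left; exists i => //; rewrite i2.
      by move=> [[i /andP[i2 ik] Gq]|Gq]; [exists i => //; rewrite i2 ltnS ltnW|exists k => //; rewrite k2 /=].
    by apply: closedU; [exact/IH/ltnW|exact: (curve_closed (curveG kn))].
  by move/(_ n (leqnn n)).
have CY : connected_component Z p `&` Y = set0.
  by apply/seteqP; split=> // q [Cq [i i2 Gq]]; rewrite -(avoid i i2).
have [N [Np NZ cN cN' NY]] := component_avoid (@hausdorff_pt R) trace_compact Zp cY CY.
have ZA : Z `<=` closure annulus `&` K.
  by move=> q [clq Kq]; split=> //; exact: (closureS domain_sub_annulus).
apply/seteqP; split; last first.
  apply: connected_component_max; first exact: connected_component_refl.
    by move=> q /connected_component_sub/ZA.
  exact: component_connected.
set Q := connected_component _ p.
have Qp : Q p by apply: connected_component_refl; exact: ZA.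
suff QN : Q `<=` N.
  by apply: connected_component_max => //; [move=> q /QN/NZ|exact: component_connected].
(* [O] shows that [N] is relatively open in the larger trace: near a point of [N] the annulus lies
   in [W]. The interior taken in [near1] keeps this inclusion valid around each nearby [z], where
   membership in [closure W] is tested. *)
pose O := interior [set q | (closure annulus `&` K) q -> N q].
have NO : N `<=` O.
  move=> q Nq; have [clq Kq] := NZ _ Nq.
  have nG i : (2 <= i < n)%N -> ~ G i q.
    by move=> i2 Gq; rewrite -[False]/(set0 q) -NY; split=> //; exists i.
  have /nbhs_interior near1 := annulus_near_domain clq nG.
  have near2 : \forall z \near q, ~ (Z `\` N) z.
    by apply: open_nbhs_nbhs; split; [exact: closed_openC|move=> []].
  rewrite /O /interior /=; apply: filterS2 near1 near2 => z z1 z2 [clz Kz].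
  apply: contrapT => nNz; apply: z2; split=> //; split=> // B nB.
  have [z' [Az' [Bz' Hz']]] := clz _ (filterI nB z1).
  by exists z'; split=> //; exact: Hz'.
have -> : Q = Q `&` N; last by move=> q [].
apply/esym; apply: (@component_connected _ (closure annulus `&` K) p).
- by exists p.
- exists O; first exact: open_interior.
  apply/seteqP; split=> q [Qq Hq]; split=> //; first exact: NO.
  by apply: (interior_subset Hq); exact: connected_component_sub Qq.
- by exists N.
Qed.

Lemma three_components (P : nat -> set (pt R)) (i : nat) (k : nat -> nat) :
  injective P ->
  (forall m, [/\ component_of Z (P m), P m `&` G 0%N !=set0 & P m `&` G 1%N !=set0]) ->
  (2 <= i < n)%N -> (k 0 < k 1 < k 2)%N -> (forall j, P (k j) `&` G i !=set0) -> False.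
Proof.
move=> injP PP /andP[i2 il] /andP[k01 k12] touch.
pose c m := if m is 0 then 0%N else if m is 1 then 1%N else i.
have cn m : (c m < n)%N by case: m => [|[|m]].
have cinj m m' : (m < 3)%N -> (m' < 3)%N -> m <> m' -> c m <> c m'.
  by case: m => [|[|[|//]]] _; case: m' => [|[|[|//]]] _ /=; move: i2; clear; lia.
have kinj j l : (j < 3)%N -> (l < 3)%N -> j <> l -> k j <> k l.
  have k02 := ltn_trans k01 k12.
  by case: j => [|[|[|//]]] _; case: l => [|[|[|//]]] _ /=; move: k01 k12 k02; clear; lia.
have Pcomp j : exists2 q, Z q & P j = connected_component Z q by have [] := PP j.
have PZ j : P j `<=` Z by have [q _ ->] := Pcomp j; exact: connected_component_sub.
have Pclosed j : closed (P j).
  have [q _ ->] := Pcomp j; apply: component_closed.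
  by apply: compact_closed; [exact: hausdorff_pt|exact: trace_compact].
have Pcompact j : compact (P j).
  exact: subclosed_compact (Pclosed j) trace_compact (PZ j).
have Pconn j : connected (P j) by have [q _ ->] := Pcomp j; exact: component_connected.
have Pdisj j l : j <> l -> P j `&` P l = set0.
  move=> jl; apply/seteqP; split=> // q [Pj Pl]; apply: jl; apply: injP.
  have [a _ Ea] := Pcomp j; have [b _ Eb] := Pcomp l.
  rewrite Ea Eb in Pj Pl *.
  by rewrite (same_connected_component Pj) (same_connected_component Pl).
have [p pP] : exists p : nat -> nat -> pt R, forall m j, P (k j) (p m j) /\ G (c m) (p m j).
  have : forall mj : nat * nat, exists q, P (k mj.2) q /\ G (c mj.1) q.
    move=> [m j] /=; have [_ [q0 t0] [q1 t1]] := PP (k j); have [q2 t2] := touch j.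
    by case: m => [|[|m]]; [exists q0|exists q1|exists q2].
  by move=> /choice[p pP]; exists (fun m j => p (m, j)) => m j; exact: (pP (m, j)).
(* A pole in [W] off the three continua. If they covered [W], the connected set [W] would lie in one
   of them, and so would [closure W], which contains the other two. *)
have ex_o : exists o, W o /\ forall j, (j < 3)%N -> ~ P (k j) o.
  apply: contrapT => H.
  have cover q : W q -> [\/ P (k 0%N) q, P (k 1%N) q | P (k 2%N) q].
    move=> Wq; apply: contrapT => nq; apply: H; exists q; split=> // j.
    by case: j => [|[|[|//]]] _ Pq; apply: nq; [constructor 1|constructor 2|constructor 3].
  have swallow j l m : j <> l -> j <> m ->
      (forall q, W q -> [\/ P j q, P l q | P m q]) -> P j w -> P l !=set0 -> False.
    move=> jl jm cov Pw [q Plq].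
    have WP : W `<=` P j.
      suff H1 : W `<=` ~` (P l `|` P m).
        by move=> z Wz; case: (cov z Wz) => // Pz; case: (H1 z Wz); [left|right].
      apply: (@connected_split _ _ _ (~` P j) cW).
      - by apply/closed_openC/closedU.
      - exact/closed_openC.
      - move=> z Wz; have [Pz|nz] := pselect (P j z); last by right.
        by left=> -[]; exact: disj (Pdisj _ _ _) Pz.
      - apply/seteqP; split=> // z [[Wz nlm] nj]; case: (cov z Wz) => //.
          by move=> ?; apply: nlm; left.
        by move=> ?; apply: nlm; right.
      - by exists w; split=> // -[]; exact: disj (Pdisj _ _ _) Pw.
    apply: (disj (Pdisj _ _ jl) _ Plq).
    rewrite (closure_id (P j)).1//; apply: (closureS WP).
    by have [] := PZ _ _ Plq.
  have neP j : P (k j) !=set0 by exists (p 0%N j); exact: (pP 0%N j).1.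
  case: (cover w Ww) => Pw.
  - by apply: (swallow (k 0%N) (k 1%N) (k 2%N)) => //; apply: kinj.
  - apply: (swallow (k 1%N) (k 0%N) (k 2%N)) => //; try by apply: kinj.
    by move=> q /cover[]; [constructor 2|constructor 1|constructor 3].
  - apply: (swallow (k 2%N) (k 0%N) (k 1%N)) => //; try by apply: kinj.
    by move=> q /cover[]; [constructor 2|constructor 3|constructor 1].
case: ex_o => o [Wo no].
have So := WS Wo.
have [phi [psi ch]] := stereographic_chart So.
(* [b m] lies beyond [G (c m)] as seen from [W]. Its component [A m] is adherent to the whole curve,
   hence to every contact point [p m j]. *)
have [b bP] : exists b : nat -> pt R, forall m,
    [/\ (S2 `\` G (c m)) (b m), ~ connected_component (S2 `\` G (c m)) (b m) w &
        G (c m) `<=` closure (connected_component (S2 `\` G (c m)) (b m))].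
  have : forall m : nat, exists q, [/\ (S2 `\` G (c m)) q, ~ connected_component (S2 `\` G (c m)) q w &
        G (c m) `<=` closure (connected_component (S2 `\` G (c m)) q)].
    move=> m; have [q Gq [nq clq]] := curve_other_side (curveG (cn m)) (domain_sub_complement (cn m) Ww).
    by exists q.
  by move=> /choice[b bP]; exists b.
pose A m := connected_component (S2 `\` G (c m)) (b m).
have oA m : sphere_open (A m) by apply: component_sphere_open; exact: curve_complement_open.
have AS m : A m `<=` S2 := sphere_open_sub (oA m).
have Aside m q : A m q -> ~ side (c m) q.
  move=> Aq wq; have [_ nb _] := bP m; apply: nb.
  exact: connected_component_trans Aq (connected_component_sym wq).
have Adisc m : A m `<=` disc (c m) by move=> q Aq; split; [exact: AS Aq|exact: Aside].
have AW m q : A m q -> ~ closure W q.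
  move=> Aq clq; have [z [Wz Hz]] := clq _ (sphere_open_near (oA m) Aq).
  exact: Aside (Hz (WS Wz)) (domain_sub_side (cn m) Wz).
have Ao m q : A m q -> q <> o.
  by move=> Aq E; apply: (AW m q Aq); rewrite E; exact: subset_closure.
have Po j q : (j < 3)%N -> P (k j) q -> S2 q /\ q <> o.
  move=> j3 Pq; split; last by move=> E; apply: (no j j3); rewrite -E.
  have [clq _] := PZ _ _ Pq; rewrite (closure_id S2).1; last exact: closed_S2.
  exact: (closureS WS) clq.
have chart_A m := chart_open ch (oA m).
have chart_side m := chart_open ch (side_open (cn m)).
case: ch => cpsi psiS phiK psiK.
have EA m : psi @^-1` A m = phi @` A m.
  apply/seteqP; split=> [z Az|_ [q Aq <-]]; first by exists (psi z); rewrite ?phiK.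
  by rewrite /= (psiK _ (AS _ _ Aq) (Ao _ _ Aq)).1.
apply: (@three_open_three_continua R (fun m => psi @^-1` A m) (fun j => phi @` P (k j)) (fun m j => phi (p m j))).
- move=> m m3; split=> //; rewrite EA; apply: connected_continuous_connected.
    exact: component_connected.
  by apply: within_for => q Aq; exact: (psiK _ (AS _ _ Aq) (Ao _ _ Aq)).2.
- move=> m m' m3 m'3 mm'; apply/seteqP; split=> // z [/= Az Az'].
  by apply: (disj (disc_disjoint (cn m) (cn m') (cinj _ _ m3 m'3 mm')) (Adisc _ _ Az) (Adisc _ _ Az')).
- move=> j j3; have wc : {within P (k j), continuous phi}.
    by apply: within_for => q /(Po _ _ j3)[Sq qo]; exact: (psiK _ Sq qo).2.
  by split; [exact: continuous_compact|exact: connected_continuous_connected].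
- move=> j l j3 l3 jl; apply/seteqP; split=> // _ [[q Pq <-] [q' Pq' E]].
  have [Sq qo] := Po _ _ j3 Pq; have [Sq' qo'] := Po _ _ l3 Pq'.
  have Eq : q' = q by rewrite -(psiK _ Sq' qo').1 E (psiK _ Sq qo).1.
  rewrite Eq in Pq'; exact: disj (Pdisj _ _ (kinj _ _ j3 l3 jl)) Pq Pq'.
- move=> m j m3 j3; apply/seteqP; split=> // z [/= Az [q Pq Eq]].
  have [Sq qo] := Po _ _ j3 Pq; rewrite -Eq (psiK _ Sq qo).1 in Az.
  by apply: (AW _ _ Az); have [] := PZ _ _ Pq.
- move=> m j m3 j3; have [Pp Gp] := pP m j; split; first by exists (p m j).
  have [Sp po] := Po _ _ j3 Pp; move=> B nB.
  have [_ _ /(_ _ Gp) clA] := bP m.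
  have [q [Aq Bq]] := clA _ ((psiK _ Sp po).2 _ nB).
  by exists (phi q); split=> //=; rewrite (psiK _ (AS _ _ Aq) (Ao _ _ Aq)).1.
- move=> m j m' m3 j3 m'3 mm' cl; have [Pp Gp] := pP m j.
  have [Sp po] := Po _ _ j3 Pp.
  have sp := curve_in_side (cn m) (cn m') (cinj _ _ m3 m'3 mm') Gp.
  have nb : nbhs (phi (p m j)) (psi @^-1` side (c m')).
    by apply: open_nbhs_nbhs; split; [exact: chart_side|rewrite /= (psiK _ Sp po).1].
  by have [z [/= Az sz]] := cl _ nb; exact: Aside Az sz.
Qed.

Lemma touches_finitely_often (P : nat -> set (pt R)) :
  injective P ->
  (forall m, [/\ component_of Z (P m), P m `&` G 0%N !=set0 & P m `&` G 1%N !=set0]) ->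
  exists N, forall i m, (2 <= i < n)%N -> (N <= m)%N -> P m `&` G i = set0.
Proof.
move=> injP PP.
have one i : (2 <= i < n)%N -> exists N, forall m, (N <= m)%N -> P m `&` G i = set0.
  move=> i2; apply: contrapT => H.
  have inf N : exists m, (N <= m)%N /\ P m `&` G i !=set0.
    apply: contrapT => nm; apply: H; exists N => m Nm; apply/eqP; apply: contrapT => /negP/set0P ne.
    by apply: nm; exists m.
  have [k0 [_ t0]] := inf 0%N; have [k1 [k01 t1]] := inf k0.+1; have [k2 [k12 t2]] := inf k1.+1.
  pose k j := if j is 0 then k0 else if j is 1 then k1 else k2.
  apply: (@three_components P i k) => //; first by rewrite /k /= k01.
  by case=> [|[|j]].
have : forall a, (a <= n)%N -> exists N, forall i m, (2 <= i < a)%N -> (N <= m)%N -> P m `&` G i = set0.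
  elim=> [_|a IH an]; first by exists 0%N => i m; rewrite ltn0 andbF.
  have [N HN] := IH (ltnW an).
  have [a2|a2] := leqP 2 a; last first.
    by exists 0%N => i m /andP[i2 ia]; have := leq_trans ia a2; rewrite ltnNge i2.
  have [|N' HN'] := one a; first by rewrite a2.
  exists (maxn N N') => i m /andP[i2]; rewrite ltnS geq_max leq_eqVlt => /orP[/eqP ->|ia] /andP[Nm N'm].
    exact: HN'.
  by apply: HN => //; rewrite i2.
by move/(_ n (leqnn n)).
Qed.

End Components.
End CurveDomain.
End Domain.

Theorem theorem2 (R : realType) (K : set (pt R)) (x y : pt R) :
  K `<=` @S2 R -> compact K -> K x -> K y ->
  (schonflies_rel K x y <->
   exists (W : set (pt R)) (n : nat) (G : nat -> set (pt R)),
     [/\ (2 <= n)%N, sphere_open W & connected W] /\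
     [/\
         (forall i, (i < n)%N -> simple_closed_curve (G i)),
         (forall i j, (i < n)%N -> (j < n)%N -> i <> j -> (G i `&` G j = set0))
       & sphere_boundary W = \bigcup_(i in [set i : nat | (i < n)%N]) G i] /\
     exists (P : nat -> set (pt R)) (L : set (pt R)),
       injective P /\
       (forall k, [/\ component_of (closure W `&` K) (P k),
                      (P k `&` G 0%N !=set0) & (P k `&` G 1%N !=set0)]) /\
       closed L /\ hausdorff_cvg P L /\ G 0%N x /\ L x /\ G 1%N y /\ L y).
Proof.
move=> KS kK Kx Ky; split.
  (* Direct implication: [U] itself is the region, bounded by [J1] and [J2]. *)
  move=> [_ [_ [_ [J1 [J2 [U [[s1 s2 J12 J1x J2y] [[[w Ow EU] bU] [P [L [injP [PP [cL [hL [Lx Ly]]]]]]]]]]]]]]].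
  pose G (i : nat) := if i is 0 then J1 else J2.
  have oO : sphere_open (@S2 R `\` (J1 `|` J2)).
    by apply: sphere_openD; apply: closedU; exact: curve_closed.
  exists U, 2%N, G; split.
    by rewrite EU; split=> //; [exact: component_sphere_open|exact: component_connected].
  split; last by exists P, L.
  split.
  - by case=> [|[|]].
  - by move=> [|[|//]] [|[|//]] _ _ ij //=; rewrite setIC.
  - rewrite bU; apply/seteqP; split=> p; first by case=> Jp; [exists 0%N|exists 1%N].
    by case=> -[|[|//]] _ Gp; [left|right].
move=> [W [n [G [[n2 oW cW] [[sG dG bW] [P [L [injP [PP [cL [hL [Gx [Lx [Gy Ly]]]]]]]]]]]]]].
have n0 : (0 < n)%N := ltnW n2.
have [w Ww] : W !=set0.
  have [p Gp] := curve_nonempty (sG _ n0).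
  have [clp _] : sphere_boundary W p by rewrite bW; exists 0%N.
  by have [q [Wq _]] := clp _ filterT; exists q.
have [N HN] := touches_finitely_often n2 oW cW Ww sG dG bW kK injP PP.
split=> //; split=> //; split.
  move=> xy; have : (G 0%N `&` G 1%N) x by split=> //; rewrite xy.
  by rewrite (dG 0%N 1%N).
exists (G 0%N), (G 1%N), (annulus G w); split.
  by split=> //; [exact: sG|exact: sG|exact: dG].
split; first exact: (annulus_betweenP n2 oW cW Ww sG bW).
(* From index [N] on the components avoid all [G i] with [2 <= i < n], so they are components of the
   trace on the closed annulus; the Hausdorff limit of the tail is the same. *)
exists (fun k => P (N + k)%N), L; split.
  by move=> k l /injP/addnI.
split.
  move=> k; have [[p Zp EP] t0 t1] := PP (N + k)%N; split=> //.
  exists p; first by case: Zp => clp Kp; split=> //; exact: (closureS (domain_sub_annulus n2 oW cW Ww bW)).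
  rewrite (trace_component_annulus n2 oW cW Ww sG dG bW kK Zp)// => i i2.
  by rewrite -EP; apply: HN => //; exact: leq_addr.
do 2 split=> //.
by move=> e e0; have [M HM] := hL e e0; exists M => k Mk; apply: HM; rewrite (leq_trans Mk) ?leq_addl.
Qed.
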